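(* Let $R$ be a commutative Noetherian ring with identity, let $\mathfrak{a}$ be an ideal of $R$, and let $M$ be a $ZD$-module over $R$. Assume that $\mathrm{Gdim}_{\mathfrak{a}}(M/N)$ is finite for every submodule $N$ of $M$ (i.e. the $\mathfrak{a}$-relative Goldie dimension of any quotient of $M$ is finite). Then: (i) If $\dim R/\mathfrak{a}=0$, then $H^i_{\mathfrak{a}}(M)$ is Artinian for all $i\geq 0$. (ii) If $d=\dim M$ is finite, then $H^d_{\mathfrak{a}}(M)$ is Artinian.
   Context: All modules are unitary. For an $R$-module $X$, $\mathrm{Z}_R(X)$ denotes the set of zero divisors on $X$, i.e. the elements $r\in R$ with $rx=0$ for some non-zero $x\in X$, and $\mathrm{Ass}_R(X)$ denotes the set of associated prime ideals of $X$. An $R$-module $M$ is called a $ZD$-module if for every submodule $N$ of $M$, the set $\mathrm{Z}_R(M/N)$ is a union of finitely many prime ideals belonging to $\mathrm{Ass}_R(M/N)$. For a prime ideal $\mathfrak{p}$ of $R$, $\mu^0(\mathfrak{p},X)$ denotes the 0-th Bass number of $X$ with respect to $\mathfrak{p}$, i.e. the (cardinal) number of copies of the injective envelope $\mathrm{E}(R/\mathfrak{p})$ in a decomposition of the injective envelope $\mathrm{E}(X)$ into a direct sum of indecomposable injective modules. The $\mathfrak{a}$-relative Goldie dimension of $X$ is $\mathrm{Gdim}_{\mathfrak{a}}X:=\sum_{\mathfrak{p}\in \mathrm{V}(\mathfrak{a})}\mu^0(\mathfrak{p},X)$, where $\mathrm{V}(\mathfrak{a})$ is the set of prime ideals of $R$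 containing $\mathfrak{a}$. $\Gamma_{\mathfrak{a}}(X)=\bigcup_{n\in\mathbb{N}}\{x\in X:\mathfrak{a}^n x=0\}$ is the $\mathfrak{a}$-torsion submodule of $X$, and the local cohomology functor $H^i_{\mathfrak{a}}(\cdot)$ is the $i$-th right derived functor of $\Gamma_{\mathfrak{a}}(\cdot)$. $\dim M$ denotes the (Krull) dimension of $M$, i.e. the supremum of lengths of chains of prime ideals in the support of $M$. *)

(* Defs.v *)
From HB Require Import structures.
From mathcomp Require Import all_boot all_algebra generic_quotient.
From mathcomp Require Import boolp classical_sets cardinality.

Set Implicit Arguments.
Unset Strict Implicit.
Unset Printing Implicit Defensive.

Import GRing.Theory.

Local Open Scope ring_scope.
Local Open Scope classical_set_scope.
Local Open Scope quotient_scope.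

(* Submodules of M are the library's [submodClosed M]; ideals, possibly equal
   to R, are the submodules of the regular module R^o. *)
Notation ideal R := (submodClosed R^o).

Section Submodule.
Variables (R : pzRingType) (M : lmodType R) (N : submodClosed M).

Record submod_of := SubmodOf { submod_val : M; _ : submod_val \in N }.

HB.instance Definition _ := [isSub for submod_val].
HB.instance Definition _ := [Choice of submod_of by <:].
HB.instance Definition _ := [SubChoice_isSubLmodule of submod_of by <:].

End Submodule.

Section QuotientModule.
Variables (R : pzRingType) (M : lmodType R) (N : submodClosed M).

Lemma submod_zmod_closed : zmod_closed N.
Proof. exact: GRing.submod_closedB (submodClosedP N). Qed.

Definition submod_zmod : zmodClosed M :=
  HB.pack_for (zmodClosed M) (GRing.SubmodClosed.sort N)
    (GRing.isZmodClosed.Build M (GRing.SubmodClosed.sort N) submod_zmod_closed).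

Definition quotmod := Quotient.quot submod_zmod.


HB.instance Definition _ := GRing.Zmodule.on quotmod.
HB.instance Definition _ :=
  EqQuotient.copy quotmod (Quotient.quot submod_zmod).
HB.instance Definition _ :=
  ZmodQuotient.copy quotmod (Quotient.quot submod_zmod).

Lemma eq_quotmod x y : (\pi_quotmod x == \pi_quotmod y) = (x - y \in N).
Proof. by rewrite -Quotient.idealrBE. Qed.

Lemma pi_quotmodD : {morph \pi_quotmod : x y / x + y}.
Proof. exact: (raddfD \pi_(Quotient.quot submod_zmod)). Qed.

Definition quotmod_scale (c : R) : quotmod -> quotmod :=
  lift_op1 quotmod ( *:%R c).

Lemma pi_quotmod_scale c :
  {morph \pi_quotmod : x / c *: x >-> quotmod_scale c x}.
Proof.
move=> x; unlock quotmod_scale; apply/eqP.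
by rewrite eq_quotmod -scalerBr rpredZ // -eq_quotmod reprK.
Qed.

Lemma quotmod_scalerA c d v :
  quotmod_scale c (quotmod_scale d v) = quotmod_scale (c * d) v.
Proof. by rewrite -[v]reprK -!pi_quotmod_scale scalerA. Qed.

Lemma quotmod_scale1r : left_id 1 quotmod_scale.
Proof. by move=> v; rewrite -[v]reprK -!pi_quotmod_scale scale1r. Qed.

Lemma quotmod_scalerDr : right_distributive quotmod_scale +%R.
Proof.
move=> c u v; rewrite -[u]reprK -[v]reprK -!pi_quotmod_scale.
by rewrite -!pi_quotmodD -!pi_quotmod_scale scalerDr.
Qed.

Lemma quotmod_scalerDl v : {morph quotmod_scale^~ v : c d / c + d}.
Proof.
by move=> c d; rewrite -[v]reprK -!pi_quotmod_scale -pi_quotmodD scalerDl.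
Qed.

HB.instance Definition _ := GRing.Zmodule_isLmodule.Build R quotmod
  quotmod_scalerA quotmod_scale1r quotmod_scalerDr quotmod_scalerDl.

End QuotientModule.

Section ChainConditions.
Variables (R : pzRingType) (M : lmodType R).

Definition noetherian_module := forall N : nat -> submodClosed M,
  (forall i, {subset N i <= N i.+1}) ->
  exists n, forall m, (n <= m)%N -> N m =i N n.

Definition artinian_module := forall N : nat -> submodClosed M,
  (forall i, {subset N i.+1 <= N i}) ->
  exists n, forall m, (n <= m)%N -> N m =i N n.

End ChainConditions.

Definition noetherian_ring (R : comPzRingType) := noetherian_module R^o.

Section Primes.
Variables (R : comPzRingType).
Implicit Types (p : ideal R) (X : lmodType R).

Definition prime_ideal p :=
  1 \notin p /\ forall x y : R, x * y \in p -> (x \in p) || (y \in p).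

Definition zero_divisors X : set R :=
  [set r | exists2 x : X, x != 0 & r *: x = 0].

Definition Ass X : set (ideal R) := [set p | prime_ideal p /\
  exists x : X, forall r : R, (r \in p) = (r *: x == 0)].

Definition ZD_module X := forall N : submodClosed X,
  exists F : set (ideal R), [/\ finite_set F, F `<=` Ass (quotmod N) &
    zero_divisors (quotmod N) = \bigcup_(p in F) [set r : R | r \in p]].

(* Equality of the fractions x / s and y / t in the localization X_p. *)
Definition eq_frac p X (x : X) (s : R) (y : X) (t : R) :=
  exists2 u : R, u \notin p & u *: (t *: x - s *: y) = 0.

(* X_p <> 0, i.e. some fraction x / s differs from 0 / 1. *)
Definition Supp X : set (ideal R) := [set p | prime_ideal p /\
  exists (x : X) (s : R), s \notin p /\ ~ eq_frac p x s 0 1].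

Definition prime_chain X (n : nat) (c : nat -> ideal R) :=
  (forall i, (i <= n)%N -> Supp X (c i)) /\
  (forall i, (i < n)%N ->
    {subset c i <= c i.+1} /\ ~ {subset c i.+1 <= c i}).

(* dim X = d for a natural number d; no d qualifies when X = 0. *)
Definition krull_dim_is X (d : nat) :=
  (exists c, prime_chain X d c) /\
  (forall n c, prime_chain X n c -> (n <= d)%N).

End Primes.

Section InjectiveModules.
Variables (R : comPzRingType).
Implicit Types (E X : lmodType R).

Definition injective_module E :=
  forall (A B : lmodType R) (f : {linear A -> B}) (g : {linear A -> E}),
    injective f -> exists h : {linear B -> E}, forall x, h (f x) = g x.

Definition essential_mono X E (iota : {linear X -> E}) :=
  injective iota /\
  forall N : submodClosed E, (exists2 y, y \in N & y != 0) ->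
    exists2 x, iota x \in N & iota x != 0.

Definition injective_envelope X E (iota : {linear X -> E}) :=
  injective_module E /\ essential_mono iota.

Definition indecomposable_module E :=
  (exists x : E, x != 0) /\
  forall A B : submodClosed E,
    (forall x, exists a b, [/\ a \in A, b \in B & x = a + b]) ->
    (forall x, x \in A -> x \in B -> x = 0) ->
    (forall x, x \in A -> x = 0) \/ (forall x, x \in B -> x = 0).

(* E is the internal direct sum of the submodules F j, j in J. *)
Definition internal_direct_sum E (J : choiceType) (F : J -> submodClosed E) :=
  (forall x, exists (s : seq J) (f : J -> E),
    (forall j, f j \in F j) /\ x = \sum_(j <- s) f j) /\
  (forall (s : seq J) (f : J -> E), uniq s -> (forall j, f j \in F j) ->
    \sum_(j <- s) f j = 0 -> forall j, j \in s -> f j = 0).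

Record indec_inj_decomposition E := {
  dec_index : choiceType;
  dec_summand : dec_index -> submodClosed E;
  dec_direct_sum : internal_direct_sum dec_summand;
  dec_injective : forall j, injective_module (submod_of (dec_summand j));
  dec_indecomposable :
    forall j, indecomposable_module (submod_of (dec_summand j)) }.

(* For a decomposition D of the injective envelope E(X), the indices of the
   summands isomorphic to E(R/p): its cardinality is mu^0(p, X). *)
Definition mu0 E (D : indec_inj_decomposition E) (p : ideal R) :
    set (dec_index D) :=
  [set j | exists iota : {linear quotmod p -> submod_of (dec_summand j)},
    injective_envelope iota].
Arguments mu0 [E] D p.

(* The disjoint union over p in V(a) of the sets [mu0 D p]: its cardinality is
   the sum of the cardinals mu^0(p, X), that is, Gdim_a X. *)
Definition Gdim E (D : indec_inj_decomposition E) (a : ideal R) :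
    set (ideal R * dec_index D) :=
  [set pj | [/\ prime_ideal pj.1, {subset a <= pj.1} & mu0 D pj.1 pj.2]].
Arguments Gdim [E] D a.

(* The injective envelope and its decomposition are unique up to isomorphism
   and exist over a Noetherian ring, so it does not matter which are used. *)
Definition finite_Gdim (a : ideal R) X :=
  exists (E : lmodType R) (iota : {linear X -> E})
    (D : indec_inj_decomposition E),
    injective_envelope iota /\ finite_set (Gdim D a).

End InjectiveModules.
Arguments mu0 [R E] D p.
Arguments Gdim [R E] D a.

Section Torsion.
Variables (R : comPzRingType).
Implicit Types (a : ideal R) (X Y : lmodType R).

Definition ideal_mul (A B : set R) : set R :=
  [set r | exists2 s : seq (R * R),
    (forall xy, xy \in s -> A xy.1 /\ B xy.2) & r = \sum_(xy <- s) xy.1 * xy.2].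

Fixpoint ideal_exp a (n : nat) : set R :=
  if n is n'.+1 then ideal_mul [set r : R | r \in a] (ideal_exp a n')
  else setT.

Lemma ideal_expS a n : ideal_exp a n.+1 `<=` ideal_exp a n.
Proof.
elim: n => [//|n IHn] r [s sP ->]; exists s => // xy /sP[axy bxy].
by split=> //; apply: IHn.
Qed.

Lemma ideal_exp_le a m n : (m <= n)%N -> ideal_exp a n `<=` ideal_exp a m.
Proof.
move=> /subnK <-; elim: (n - m)%N => [//|k IHk] r /ideal_expS; exact: IHk.
Qed.

Definition torsion_pred a X : {pred X} :=
  fun x => `[< exists n, forall r, ideal_exp a n r -> r *: x = 0 >].
Arguments torsion_pred a X : clear implicits.

Lemma torsion_subsemimod_closed a X : subsemimod_closed (torsion_pred a X).
Proof.
apply: GRing.submod_closed_semi; split.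
  by apply/asboolP; exists 0%N => r _; rewrite scaler0.
move=> c x y /asboolP[m xP] /asboolP[n yP]; apply/asboolP.
exists (maxn m n) => r ar; rewrite scalerDr scalerA mulrC -scalerA.
rewrite xP ?scaler0 ?add0r ?yP //; apply: ideal_exp_le ar;
  by rewrite (leq_maxl, leq_maxr).
Qed.

HB.instance Definition _ a X := GRing.isSubmodClosed.Build R X
  (torsion_pred a X) (@torsion_subsemimod_closed a X).

Definition torsion a X : lmodType R := submod_of (torsion_pred a X).

End Torsion.
Arguments torsion_pred [R] a X.

Section TorsionFunctor.
Variables (R : comPzRingType) (a : ideal R) (X Y : lmodType R).
Variable f : {linear X -> Y}.

Lemma torsion_map_subproof (x : torsion a X) :
  f (val x) \in torsion_pred a Y.
Proof.
have /asboolP[n xP] := valP x; apply/asboolP; exists n => r /xP rx0.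
by rewrite -linearZ rx0 linear0.
Qed.

Definition torsion_map (x : torsion a X) : torsion a Y :=
  SubmodOf (torsion_map_subproof x).

Lemma torsion_map_linear : linear torsion_map.
Proof. by move=> c x y; apply: val_inj; rewrite /= linearP. Qed.

HB.instance Definition _ := GRing.isLinear.Build R (torsion a X) (torsion a Y)
  *:%R torsion_map torsion_map_linear.

End TorsionFunctor.
Arguments torsion_map [R] a [X Y] f x.

Record cochain_complex (R : pzRingType) := CochainComplex {
  cochain :> nat -> lmodType R;
  diff : forall i, {linear cochain i -> cochain i.+1};
  diffK : forall i x, diff i.+1 (diff i x) = 0 }.

Section Cohomology.
Variables (R : pzRingType) (C : cochain_complex R) (i : nat).

Definition cocycle : {pred C i} := fun x => diff C i x == 0.

Lemma cocycle_subsemimod_closed : subsemimod_closed cocycle.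
Proof.
apply: GRing.submod_closed_semi; split; first by rewrite unfold_in linear0.
by move=> c x y /eqP dx /eqP dy; rewrite unfold_in linearP dx dy scaler0 addr0.
Qed.

HB.instance Definition _ := GRing.isSubmodClosed.Build R (C i)
  cocycle cocycle_subsemimod_closed.

Definition is_coboundary : forall j, C j -> Prop :=
  fun j => match j with
  | 0 => fun x => x = 0
  | k.+1 => fun x => exists y, diff C k y = x
  end.

Definition coboundary : {pred submod_of cocycle} :=
  fun z => `[< is_coboundary (val z) >].

Lemma coboundary_subsemimod_closed : subsemimod_closed coboundary.
Proof.
have lin j c (x y : C j) :
    is_coboundary x -> is_coboundary y -> is_coboundary (c *: x + y).
  case: j x y => [|k] x y /=; first by move=> -> ->; rewrite scaler0 addr0.
  by move=> [u <-] [v <-]; exists (c *: u + v); rewrite linearP.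
apply: GRing.submod_closed_semi; split.
  apply/asboolP; rewrite linear0; case: (i) => [//|k].
  by exists 0; rewrite linear0.
move=> c x y /asboolP xB /asboolP yB; apply/asboolP.
by rewrite linearP; exact: lin.
Qed.

HB.instance Definition _ := GRing.isSubmodClosed.Build R (submod_of cocycle)
  coboundary coboundary_subsemimod_closed.

Definition cohomology : lmodType R := quotmod coboundary.

End Cohomology.

Section TorsionComplex.
Variables (R : comPzRingType) (a : ideal R) (C : cochain_complex R).

Lemma torsion_mapK i x :
  torsion_map a (diff C i.+1) (torsion_map a (diff C i) x) = 0.
Proof. by apply: val_inj; rewrite /= diffK. Qed.

Definition torsion_complex : cochain_complex R := CochainComplex torsion_mapK.

End TorsionComplex.

Record injective_resolution (R : comPzRingType) (M : lmodType R) := {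
  res_complex :> cochain_complex R;
  res_injective : forall i, injective_module (res_complex i);
  res_aug : {linear M -> res_complex 0};
  res_aug_inj : injective res_aug;
  res_exact0 : forall x,
    diff res_complex 0 x = 0 <-> exists m, res_aug m = x;
  res_exactS : forall i x,
    diff res_complex i.+1 x = 0 <-> exists y, diff res_complex i y = x }.

(* H^i_a(M), computed as the i-th right derived functor of the a-torsion
   functor from an injective resolution I of M; another choice of I gives an
   isomorphic module. *)
Definition local_cohomology (R : comPzRingType) (a : ideal R) (M : lmodType R)
    (I : injective_resolution M) (i : nat) : lmodType R :=
  cohomology (torsion_complex a I) i.

(* Main.v *)
Require Import Defs.
From HB Require Import structures.
From mathcomp Require Import all_boot all_algebra.
From mathcomp Require Import generic_quotient boolp classical_sets cardinality.

(** Both claims are instances of one statement, [local_cohomology_artinian]: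
    if V(a) contains no two comparable primes, or if dim M <= n, then H^n_a(M)
    is Artinian.

    For n = 0, H^0_a(M) is Gamma_a(M), and it lies in the direct sum of those
    summands E(R / p) of E(M) with p in V(a). Finiteness of the relative Goldie
    dimension says that there are finitely many of them, and the dimension
    hypothesis that each p is maximal, so that each E(R / p) is Artinian
    ([dcc_uniform], [dcc_torsion]).

    For n > 0, divide M by its a-torsion, which does not change H^n. As
    quotients of M are ZD-modules, prime avoidance gives an x in a that is
    regular on the a-torsion-free quotient M / L ([ZD_regular_element]). Since
    H^n_a(M) is x-torsion, Melkersson's criterion ([dcc_locally_nilpotent])
    reduces the claim to the kernel (0 : x) of x on H^n_a(M), which is a
    quotient of H^(n-1)_a(M / (L + x M)). The dimension drops by one because x
    is regular ([dim_mod_regular]), and the induction goes on.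

    This induction would need injective resolutions of all the quotients of M
    that occur, and long exact sequences between them. Instead it is carried
    out on a class of complexes that contains the resolutions of M and is closed
    under the only operation needed, the homotopy fibre of multiplication by x:
    the complexes of injective modules whose cohomology is a-torsion below some
    degree k, a quotient of M in degree k, and zero above k
    ([torsion_resolution], [fiber_resolution]). The a-torsion in degrees up to k
    is harmless: Gamma_a(E) is a direct summand of every injective E
    ([torsion_summand]), so that modulo torsion such a complex consists of
    injective modules, is exact below k and hence contractible there
    ([torsion_contraction]).

    Artinianness of a subquotient Z / B is expressed on Z itself
    ([dcc_between]), and is transported along linear relations
    ([dcc_transfer]), which replace the connecting maps. *)

Set Implicit Arguments.
Unset Strict Implicit.
Unset Printing Implicit Defensive.

Import GRing.Theory.

(** * Submodules and the descending chain condition *)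

Section Submodules.
Local Open Scope ring_scope.
Variable R : comPzRingType.
Implicit Types X Y : lmodType R.

Definition submodule X (P : X -> Prop) :=
  P 0 /\ forall c x y, P x -> P y -> P (c *: x + y).

Lemma submodule0 X (P : X -> Prop) : submodule P -> P 0.
Proof. by case. Qed.

Lemma submoduleZ X (P : X -> Prop) c x : submodule P -> P x -> P (c *: x).
Proof. by move=> [P0 Pl] Px; rewrite -[_ *: _]addr0; exact: Pl. Qed.

Lemma submoduleD X (P : X -> Prop) x y :
  submodule P -> P x -> P y -> P (x + y).
Proof. by move=> [P0 Pl] Px Py; rewrite -[x]scale1r; exact: Pl. Qed.

Lemma submoduleN X (P : X -> Prop) x : submodule P -> P x -> P (- x).
Proof. by move=> Ps Px; rewrite -scaleN1r; exact: submoduleZ. Qed.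

Lemma submoduleB X (P : X -> Prop) x y :
  submodule P -> P x -> P y -> P (x - y).
Proof. by move=> Ps Px Py; apply: submoduleD => //; exact: submoduleN. Qed.

Lemma submodule_mem X (N : submodClosed X) : submodule (fun x => x \in N).
Proof.
by split=> [|c x y xN yN]; rewrite ?rpred0 // rpredD ?rpredZ.
Qed.

Section MkSubmod.
Variables (X : lmodType R) (P : X -> Prop) (sP : submodule P).

Definition mksubmod_pred of submodule P : {pred X} := fun x => `[< P x >].

Lemma mksubmod_closed : subsemimod_closed (mksubmod_pred sP).
Proof.
case: (sP) => P0 Pl; apply: GRing.submod_closed_semi; split.
  exact/asboolP.
by move=> c x y /asboolP Px /asboolP Py; apply/asboolP; exact: Pl.
Qed.

HB.instance Definition _ := GRing.isSubmodClosed.Build R X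
  (mksubmod_pred sP) mksubmod_closed.

Definition mksubmod : submodClosed X := mksubmod_pred sP.

Lemma mksubmodP x : x \in mksubmod <-> P x.
Proof. by split=> /asboolP. Qed.

End MkSubmod.

(** The descending chain condition for the submodules lying between B and Z,
    i.e. for the subquotient Z / B: it makes sense without forming Z / B, which
    lets cohomology be handled on cocycles. *)
Definition dcc_between X (B Z : X -> Prop) :=
  forall N : nat -> X -> Prop, (forall i, submodule (N i)) ->
    (forall i x, N i.+1 x -> N i x) -> (forall i x, B x -> N i x) ->
    (forall i x, N i x -> Z x) ->
  exists n, forall m, (n <= m)%N -> forall x, N n x -> N m x.

Lemma chain_le X (N : nat -> X -> Prop) :
  (forall i x, N i.+1 x -> N i x) ->
  forall n m, (n <= m)%N -> forall x, N m x -> N n x.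
Proof.
move=> Ns n m /subnK <-; elim: (m - n)%N => [//|k IHk] x Nx.
exact/IHk/Ns.
Qed.

Lemma dcc_artinian X : dcc_between (fun x : X => x = 0) (fun _ => True) ->
  artinian_module X.
Proof.
move=> dccX N Ndec.
have [||||n nP] := dccX (fun i x => x \in N i) => //.
- by move=> i; exact: submodule_mem.
- by move=> i x ->; rewrite rpred0.
exists n => m lenm x; apply/idP/idP; last exact: nP.
exact: (@chain_le _ (fun i x => x \in N i) Ndec _ _ lenm).
Qed.

Lemma dcc_mono X (B B' Z Z' : X -> Prop) :
  (forall x, B x -> B' x) -> (forall x, Z' x -> Z x) ->
  dcc_between B Z -> dcc_between B' Z'.
Proof.
move=> sB sZ dccX N Ns Nd BN NZ.
by apply: dccX => // i x; [move/sB/BN|move/NZ/sZ].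
Qed.

(** A linear relation P between X and Y, defined on all of Z_X and whose
    elements over B_Y lie over B_X, exhibits Z_X / B_X as a subquotient of
    Z_Y / B_Y. *)
Lemma dcc_transfer X Y (P : X -> Y -> Prop) (BX ZX : X -> Prop)
    (BY ZY : Y -> Prop) :
  P 0 0 ->
  (forall c x y x' y', P x y -> P x' y' -> P (c *: x + x') (c *: y + y')) ->
  submodule BY -> submodule ZY -> (forall y, BY y -> ZY y) ->
  (forall x, ZX x -> exists2 y, ZY y & P x y) ->
  (forall x y, ZX x -> P x y -> BY y -> BX x) ->
  dcc_between BY ZY -> dcc_between BX ZX.
Proof.
move=> P0 Pl BYs ZYs BZ Ptot Pinj dccY N Ns Nd BN NZ.
pose N' i y := exists x y' b, [/\ N i x, ZY y', P x y', BY b & y = y' + b].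
have [||||n nP] := dccY N'.
- move=> i; split=> [|c ? ? [x [y [b [Nx Zy Pxy Bb ->]]]]].
    exists 0, 0, 0; split; rewrite ?addr0 //; by
      [exact: submodule0|exact: submodule0].
  move=> [x' [y' [b' [Nx' Zy' Pxy' Bb' ->]]]].
  exists (c *: x + x'), (c *: y + y'), (c *: b + b').
  split; [by case: (Ns i) => _; apply|by case: ZYs => _; apply|exact: Pl| |].
    by case: BYs => _; apply.
  by rewrite scalerDr addrACA.
- move=> i _ [x [y [b [Nx Zy Pxy Bb ->]]]].
  by exists x, y, b; split=> //; exact: Nd.
- move=> i y By; exists 0, 0, y.
  by rewrite add0r; split=> //; [exact: submodule0|exact: submodule0].
- move=> i _ [x [y [b [_ Zy _ /BZ Zb ->]]]]; exact: submoduleD.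
exists n => m lenm x Nx; have [y Zy Pxy] := Ptot _ (NZ _ _ Nx).
have [|x' [y' [b [Nx' Zy' Pxy' Bb yE]]]] := nP m lenm y.
  exists x, y, 0; rewrite addr0; split=> //; exact: submodule0.
have Bxx' : BX (x' - x).
  have Pd : P (-1 *: x + x') (-1 *: y + y') by exact: Pl.
  rewrite -scaleN1r addrC; apply: Pinj Pd _.
    apply: (NZ n); case: (Ns n) => _; apply=> //.
    exact: chain_le lenm _ _.
  by rewrite scaleN1r yE opprD addrAC addNr add0r; exact: submoduleN.
have -> : x = x' - (x' - x) by rewrite opprB addrCA subrr addr0.
by apply: submoduleB => //; exact: BN.
Qed.

(** Melkersson's criterion for one element r. As r is locally nilpotent, nested
    submodules N <= N' with the same layers r^k N /\ (0 : r) are equal; and the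
    layers of a chain form a doubly decreasing family of submodules of the
    Artinian module (0 : r), so that they all become stationary together. *)
Lemma dcc_locally_nilpotent X (B Z : X -> Prop) (r : R) :
  submodule B -> submodule Z -> (forall x, B x -> Z x) ->
  (forall z, Z z -> exists n, B (r ^+ n *: z)) ->
  dcc_between B (fun z => Z z /\ B (r *: z)) -> dcc_between B Z.
Proof.
move=> Bs Zs BZ nilr dccr N Ns Nd BN NZ.
pose L k i z := exists n b, [/\ N i n, B b, z = r ^+ k *: n + b & B (r *: z)].
have Ls k i : submodule (L k i).
  split=> [|c _ _ [n [b [Nn Bb -> Brz]]] [n' [b' [Nn' Bb' -> Brz']]]].
    exists 0, 0; rewrite !(scaler0, addr0); split=> //; by
      [exact: submodule0|exact: submodule0].
  exists (c *: n + n'), (c *: b + b'); split.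
  - by case: (Ns i) => _; apply.
  - by case: Bs => _; apply.
  - by rewrite !scalerDr addrACA !scalerA [r ^+ k * c]mulrC.
  - rewrite [_ *: (_ + _)]scalerDr [r *: (c *: _)]scalerA mulrC -scalerA.
    by case: Bs => _; apply.
have Lz k i z : L k i z -> Z z /\ B (r *: z).
  move=> [n [b [Nn Bb -> Brz]]]; split=> //.
  apply: submoduleD => //; last exact: BZ.
  apply: submoduleZ => //; exact: NZ Nn.
have LB k i z : B z -> L k i z.
  move=> Bz; exists 0, z; rewrite scaler0 add0r; split=> //.
    exact: submodule0.
  exact: submoduleZ.
have Lk k i z : L k.+1 i z -> L k i z.
  move=> [n [b [Nn Bb -> Brz]]]; exists (r *: n), b; split=> //.
    exact: submoduleZ.
  by rewrite scalerA -exprSr.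
have Li k i z : L k i.+1 z -> L k i z.
  by move=> [n [b [/Nd Nn Bb -> Brz]]]; exists n, b.
have [k0 k0P] : exists k0, forall m, (k0 <= m)%N ->
    forall z, L k0 k0 z -> L m m z.
  by apply: (dccr (fun k => L k k)) => [i|i z /Lk/Li|i z|i z /Lz] //; exact: LB.
have [i1 i1P] : exists i1, forall k, (k < k0)%N -> forall m, (i1 <= m)%N ->
    forall z, L k i1 z -> L k m z.
  elim: {k0P}k0 => [|k [i1 IHi]]; first by exists 0%N.
  have [|i2 i2P] := dccr (L k) (Ls k) (Li k) (LB k); first by move=> i z /Lz.
  exists (maxn i1 i2) => j; rewrite ltnS leq_eqVlt => /orP[/eqP ->|ltjk] m.
    rewrite geq_max => /andP[_ lem] z /(chain_le (Li k) (leq_maxr i1 i2)).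
    exact: i2P.
  rewrite geq_max => /andP[lem _] z /(chain_le (Li j) (leq_maxl i1 i2)).
  exact: IHi.
exists (maxn i1 k0) => m; rewrite geq_max => /andP[lei1 lek0].
have LL k z : L k (maxn i1 k0) z -> L k m z.
  case: (ltnP k k0) => [ltk|lek]; last first.
    move=> /(chain_le (Li k) (leq_maxr _ _)).
    move=> /(chain_le (fun k z => @Lk k k0 z) lek).
    move=> /(k0P (maxn k m)); rewrite leq_max lek0 orbT => /(_ isT).
    move=> /(chain_le (Li _) (leq_maxr _ _)).
    exact: (chain_le (fun k z => @Lk k m z) (leq_maxl _ _)).
  by move=> /(chain_le (Li k) (leq_maxl _ _)); exact: i1P.
move=> x Nx; have [k Bk] := nilr _ (NZ _ _ Nx).
elim: k x Nx Bk => [x _|k IHk x Nx Bk].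
  by rewrite expr0 scale1r; exact: BN.
have /LL[n [b [Nn Bb xE Brx]]] : L k (maxn i1 k0) (r ^+ k *: x).
  exists x, 0; rewrite addr0; split=> //; first exact: submodule0.
  by rewrite scalerA -exprS.
rewrite -[x](subrK n); apply: submoduleD => //; apply: IHk.
  apply: submoduleB => //; apply: chain_le Nn => //.
  by rewrite geq_max lei1.
by rewrite scalerBr xE addrC addKr.
Qed.

(** Submodules N <= N' of A + B are equal as soon as they have the same
    intersection with B and the same image in (A + B) / B. *)
Lemma dcc_add X (A B : X -> Prop) : submodule A -> submodule B ->
  dcc_between (fun x => x = 0) A -> dcc_between (fun x => x = 0) B ->
  dcc_between (fun x => x = 0) (fun x => exists a b, [/\ A a, B b & x = a + b]).
Proof.
move=> As Bs dccA dccB N Ns Nd N0 NAB.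
have [||||n1 n1P] := dccB (fun i x => N i x /\ B x).
- move=> i; split=> [|c x y [Nx Bx] [Ny By]].
    by split; exact: submodule0.
  by split; [case: (Ns i) => _; apply|case: Bs => _; apply].
- by move=> i x [/Nd].
- by move=> i x ->; split; exact: submodule0.
- by move=> i x [].
have [||||n2 n2P] := dccA (fun i x => A x /\ exists2 b, B b & N i (x + b)).
- move=> i; split=> [|c x y [Ax [b Bb Nxb]] [Ay [b' Bb' Nyb]]].
    split; first exact: submodule0.
    by exists 0; rewrite ?addr0; exact: submodule0.
  split; first by case: As => _; apply.
  exists (c *: b + b'); first by case: Bs => _; apply.
  by rewrite addrACA -scalerDr; case: (Ns i) => _; apply.
- by move=> i x [Ax [b Bb /Nd Nxb]]; split=> //; exists b.
- move=> i x ->; split; first exact: submodule0.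
  by exists 0; rewrite ?addr0; exact: submodule0.
- by move=> i x [].
exists (maxn n1 n2) => m; rewrite geq_max => /andP[le1 le2] x Nx.
have [a [b [Aa Bb xE]]] := NAB _ _ Nx.
have [|_ [b' Bb' Nm]] := n2P m le2 a.
  split=> //; exists b => //; rewrite -xE.
  exact: chain_le (leq_maxr n1 n2) _ Nx.
have [|Nbb _] := n1P m le1 (b - b').
  split; last exact: submoduleB.
  have -> : b - b' = x - (a + b') by rewrite xE opprD addrACA subrr add0r.
  apply: submoduleB => //; first exact: chain_le (leq_maxl n1 n2) _ Nx.
  exact: chain_le le1 _ Nm.
have -> : x = (a + b') + (b - b') by rewrite xE addrACA [b' - b']subrr addr0.
exact: submoduleD.
Qed.

End Submodules.

(** * Ideals of a Noetherian ring *)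

Section Noetherian.
Local Open Scope ring_scope.
Variable R : comPzRingType.
Implicit Types (X : lmodType R) (I J S : R -> Prop).

Notation idealp I := (submodule (I : R^o -> Prop)).

Definition primep I := ~ I 1 /\ forall x y, I (x * y) -> I x \/ I y.

Lemma idealM I c x : idealp I -> I x -> I (c * x).
Proof. by move=> Is; exact: (@submoduleZ _ R^o). Qed.

Lemma idealMr I c x : idealp I -> I x -> I (x * c).
Proof. by rewrite mulrC; exact: idealM. Qed.

Lemma primeX I x n : primep I -> I (x ^+ n) -> I x.
Proof.
move=> [I1 Ip]; elim: n => [/I1 //|n IHn]; rewrite exprS.
by case/Ip.
Qed.

Lemma ann_ideal X (x : X) : idealp (fun r => r *: x = 0).
Proof.
split=> [|c r s rx0 sx0]; first by rewrite scale0r.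
by rewrite scalerDl sx0 addr0 -scalerA rx0 scaler0.
Qed.

Lemma colon_ideal X (N : X -> Prop) (x : X) : submodule N ->
  idealp (fun r => N (r *: x)).
Proof.
move=> Ns; split=> [|c r s Nr Nt]; first by rewrite scale0r; exact: submodule0.
by rewrite scalerDl -scalerA; case: Ns => _; apply.
Qed.

Hypothesis noethR : noetherian_ring R.

Lemma noetherian_chain (I : nat -> R -> Prop) : (forall i, idealp (I i)) ->
  (forall i x, I i x -> I i.+1 x) ->
  exists n, forall m, (n <= m)%N -> forall x, I m x -> I n x.
Proof.
move=> Is Ii.
have [|n nP] := noethR (N := fun i => mksubmod (Is i)).
  by move=> i x /mksubmodP/Ii Ix; apply/mksubmodP.
exists n => m lenm x Ix; apply/(mksubmodP (Is n)).
by rewrite -(nP m lenm) ; apply/(mksubmodP (Is m)).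
Qed.

Lemma noetherian_max (F : (R -> Prop) -> Prop) I0 :
  (forall I, F I -> idealp I) -> F I0 ->
  exists I, [/\ F I, forall x, I0 x -> I x &
    forall J, F J -> (forall x, I x -> J x) -> forall x, J x -> I x].
Proof.
move=> Fs FI0; apply: contrapT => nomax.
pose T := {I : R -> Prop | F I /\ forall x, I0 x -> I x}.
pose le (I J : T) := (forall x, sval I x -> sval J x) /\
  exists2 x, sval J x & ~ sval I x.
have [|f [_ fP]] := @dependent_choice T le _ (exist _ I0 (conj FI0 (fun x => id))).
  move=> [I [FI I0I]]; apply: cid; apply: contrapT => noJ.
  apply: nomax; exists I; split=> // J FJ IJ x Jx; apply: contrapT => nIx.
  apply: noJ; have J0 : forall x, I0 x -> J x by move=> y /I0I/IJ.
  by exists (exist _ J (conj FJ J0)); split=> //=; exists x.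
have [||n nP] := @noetherian_chain (fun i => sval (f i)).
- by move=> i; apply: Fs; case: (f i) => I [].
- by move=> i x; case: (fP i) => + _; apply.
by have [_ [x fx]] := fP n; apply; apply: (nP n.+1).
Qed.

Lemma ideal_fg I : idealp I -> exists s : seq R, (forall x, x \in s -> I x) /\
  forall J, idealp J -> (forall x, x \in s -> J x) -> forall x, I x -> J x.
Proof.
move=> Is.
pose span (s : seq R) r := forall J, idealp J ->
  (forall x, x \in s -> J x) -> J r.
have spans s : idealp (span s).
  split=> [J Js sJ|c x y xs ys J Js sJ]; first exact: (@submodule0 _ R^o).
  by case: (Js) => _; apply; [exact: xs|exact: ys].
pose F K := exists2 s : seq R, (forall x, x \in s -> I x) & K = span s.
have [||_ [[s sI ->] _ max]] := @noetherian_max F (span [::]).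
- by move=> _ [s _ ->].
- by exists [::].
exists s; split=> // J Js sJ x Ix.
suff sx : span s x by exact: sx.
apply: (max (span (x :: s))); last by move=> L Ls; apply; rewrite inE eqxx.
  by exists (x :: s) => // y; rewrite in_cons => /orP[/eqP ->|/sI].
move=> y sy L Ls xsL; apply: sy => // z zs.
by apply: xsL; rewrite inE zs orbT.
Qed.

(** An ideal maximal among those that avoid a multiplicative set is prime. *)
Lemma prime_avoiding I S : idealp I -> S 1 -> (forall x y, S x -> S y -> S (x * y)) ->
  (forall x, I x -> ~ S x) ->
  exists p, [/\ idealp p, primep p, forall x, I x -> p x & forall x, p x -> ~ S x].
Proof.
move=> Is S1 SM IS.
pose F J := idealp J /\ forall x, J x -> ~ S x.
have [p [[ps pS] Ip max]] := @noetherian_max F I (fun J => @proj1 _ _) (conj Is IS).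
have out x : ~ p x -> exists y c, p y /\ S (y + c * x).
  move=> npx; apply: contrapT => noy; apply: npx.
  apply: (max (fun z => exists y c, p y /\ z = y + c * x)).
  - split=> [|_ [y [c [py ->]]] Sz]; last by apply: noy; exists y, c.
    split=> [|d _ _ [y [c [py ->]]] [z [e [pz ->]]]].
      by exists 0, 0; rewrite mul0r addr0; split=> //; exact: (submodule0 ps).
    exists (d * y + z), (d * c + e); split.
      by case: ps => _; apply.
    by rewrite /GRing.scale /= mulrDr mulrDl addrACA mulrA.
  - by move=> y py; exists y, 0; rewrite mul0r addr0.
  - by exists 0, 1; rewrite mul1r add0r; split=> //; exact: (submodule0 ps).
exists p; split=> //; split=> [/pS //|x y pxy].
have [px|/out[u [c [pu Su]]]] := EM (p x); first by left.
have [py|/out[v [d [pv Sv]]]] := EM (p y); first by right.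
exfalso; apply: (pS _ _ (SM _ _ Su Sv)).
rewrite mulrDl; apply: (@submoduleD _ R^o _ _ _ ps).
  exact: idealMr.
rewrite mulrDr; apply: (@submoduleD _ R^o _ _ _ ps).
  exact: idealM.
by rewrite mulrACA; exact: idealM.
Qed.

(** A maximal element among the annihilators of the nonzero multiples of y is
    prime. *)
Lemma associated_prime X (y : X) : y != 0 ->
  exists r, r *: y != 0 /\ primep (fun s => s *: (r *: y) = 0).
Proof.
move=> y0; pose F I := exists2 r, r *: y != 0 & I = (fun s => s *: (r *: y) = 0).
have [I [[r ry0 ->] _ max]] : exists I, [/\ F I,
    forall x, (fun s => s *: (1 *: y) = 0) x -> I x &
    forall J, F J -> (forall x, I x -> J x) -> forall x, J x -> I x].
  apply: noetherian_max; last by exists 1; rewrite ?scale1r.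
  by move=> I [r _ ->]; exact: ann_ideal.
exists r; split=> //; split=> [|u v uv0]; first by rewrite scale1r; exact/eqP.
have [vr0|vr0] := eqVneq (v *: (r *: y)) 0; first by right.
left; apply: (max (fun s => s *: (v *: (r *: y)) = 0)).
- by exists (v * r); rewrite -scalerA.
- by move=> x xr0 /=; rewrite scalerA mulrC -scalerA xr0 scaler0.
- by rewrite scalerA.
Qed.

(** If the annihilators of the t^n y stabilise at n and t^n y <> 0, then t is
    injective on R (t^n y), so that no nonzero multiple of t^n y can be killed
    by a power of t. *)
Lemma nilpotent_essential X (t : R) (y : X) :
  (forall r, r *: y != 0 -> exists s n,
     s *: (r *: y) != 0 /\ t ^+ n *: (s *: (r *: y)) = 0) ->
  exists n, t ^+ n *: y = 0.
Proof.
move=> ess.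
have [||n nP] := @noetherian_chain (fun i r => r *: (t ^+ i *: y) = 0).
- by move=> i; exact: ann_ideal.
- move=> i r r0; rewrite exprS -scalerA scalerA mulrC -scalerA r0.
  by rewrite scaler0.
exists n; apply/eqP; apply: contraT => /ess[s [m [sy0]]].
elim: m => [|m IHm] mP.
  by rewrite expr0 scale1r in mP; rewrite mP eqxx in sy0.
apply: IHm; have := nP n.+1 (leqnSn n) (t ^+ m * s).
rewrite -!scalerA; apply; rewrite -[in RHS]mP !scalerA exprS (exprS t m).
by congr (_ *: _); rewrite !mulrA; congr (_ * _); rewrite mulrC mulrA.
Qed.

End Noetherian.

(** By induction on the number of primes: a prime contained in p_i can be
    dropped from the list, as what avoids p_i avoids it. If no p_j is contained
    in p_i and x in a avoids every p_j but lies in p_i, then x is corrected by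
    an element of a outside p_i which lies in all the p_j. *)
Lemma prime_avoidance (R : comPzRingType) (T : eqType) (a : R -> Prop)
    (p : T -> R -> Prop) (s : seq T) :
  submodule (a : R^o -> Prop) ->
  (forall i, i \in s -> submodule (p i : R^o -> Prop) /\ primep (p i)) ->
  (forall i, i \in s -> exists2 x, a x & ~ p i x) ->
  exists2 x, a x & forall i, i \in s -> ~ p i x.
Proof.
move=> as_; have [n] := ubnP (size s); elim: n s => // n IHn [_ _ _|i s].
  by exists 0%R => //; exact: (@submodule0 _ R^o).
rewrite /= ltnS => lts pP aP; have [||x ax xP] := IHn s lts.
- by move=> j js; apply: pP; rewrite inE js orbT.
- by move=> j js; apply: aP; rewrite inE js orbT.
have [pix|npix] := EM (p i x); last first.
  by exists x => // j; rewrite in_cons => /orP[/eqP ->|/xP].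
have [[ps pp] [y ay npy]] := (pP i (mem_head i s), aP i (mem_head i s)).
have [[q qs qp]|noq] := EM (exists2 q, q \in s & forall x, p q x -> p i x).
  have [|||z az zP] := IHn (i :: [seq j <- s | j != q]).
  - apply: leq_trans lts; rewrite /= ltnS size_filter.
    rewrite -(count_predC (fun j => j != q) s) -addn1 leq_add2l -has_count.
    by apply/hasP; exists q => //=; rewrite eqxx.
  - move=> j; rewrite inE mem_filter => /orP[/eqP ->|/andP[_ js]].
      exact/pP/mem_head.
    by apply: pP; rewrite inE js orbT.
  - move=> j; rewrite inE mem_filter => /orP[/eqP ->|/andP[_ js]].
      exact/aP/mem_head.
    by apply: aP; rewrite inE js orbT.
  exists z => // j; rewrite in_cons => /orP[/eqP ->|js]; first exact/zP/mem_head.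
  have [->|jq] := eqVneq j q; last by apply: zP; rewrite inE mem_filter jq [_ \in s]js orbT.
  by move=> /qp; exact/zP/mem_head.
have [z [az npz zP]] : exists z, [/\ a z, ~ p i z & forall j, j \in s -> p j z].
  have : forall j, j \in s -> submodule (p j : R^o -> Prop).
    by move=> j js; case: (pP j) => //; rewrite inE js orbT.
  have {xP lts pP aP} : forall q, q \in s -> exists2 x, p q x & ~ p i x.
    move=> q qs; apply: contrapT => nox; apply: noq; exists q => // z pz.
    by apply: contrapT => npz; apply: nox; exists z.
  elim: s {noq} => [|j s IHs] sP ss; first by exists y.
  have [||z [az npz zP]] := IHs.
  - by move=> q qs; apply: sP; rewrite inE qs orbT.
  - by move=> q qs; apply: ss; rewrite inE qs orbT.
  have [w pw npw] := sP j (mem_head j s).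
  exists (w * z)%R; split; first exact: idealM.
    by case: pp => _ pp /pp[].
  move=> q; rewrite in_cons => /orP[/eqP ->|qs]; first by apply: idealMr => //; exact/ss/mem_head.
  by apply: idealM; [apply: ss; rewrite inE qs orbT|exact: zP].
exists (x + z)%R; first exact: (@submoduleD _ R^o).
have xE : (x = (x + z) - z)%R by rewrite addrK.
move=> j; rewrite in_cons => /orP[/eqP ->|js] pxz.
  by apply: npz; rewrite -[z](addKr x) addrC; exact: (@submoduleB _ R^o).
apply: (xP j js); rewrite xE; apply: (@submoduleB _ R^o) => //.
  by case: (pP j); rewrite // inE js orbT.
exact: zP.
Qed.

(** * Injective modules *)

Section LinearRelations.
Local Open Scope ring_scope.
Variables (R : comPzRingType) (X Y : lmodType R).

Definition linear_of (f : X -> Y) of linear f := f.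

Section Linear.
Variables (f : X -> Y) (lf : linear f).
HB.instance Definition _ := GRing.isLinear.Build R X Y *:%R (linear_of lf) lf.
Definition mklinear : {linear X -> Y} := linear_of lf.
End Linear.

Lemma linear_from_relation (P : X -> Y -> Prop) :
  (forall x, exists y, P x y) -> (forall y, P 0 y -> y = 0) ->
  (forall c x y x' y', P x y -> P x' y' -> P (c *: x + x') (c *: y + y')) ->
  exists f : {linear X -> Y}, forall x, P x (f x).
Proof.
move=> Ptot P0 Pl; have [f fP] := choice Ptot.
suff lf : linear f by exists (mklinear lf).
move=> c x y; apply/eqP; rewrite -subr_eq0; apply/eqP/P0.
have := Pl (-1) _ _ _ _ (Pl c _ _ _ _ (fP x) (fP y)) (fP (c *: x + y)).
by rewrite !scaleN1r addNr [- (_ + _) + _]addrC.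
Qed.

End LinearRelations.

Section Injectives.
Local Open Scope ring_scope.
Variable R : comPzRingType.
Implicit Types X Y E : lmodType R.

(** Formulated for graphs, so that a map defined on a submodule of Y, or on the
    image of some other map, extends without that module being formed. *)
Lemma injective_extend Y E (P : Y -> E -> Prop) : injective_module E ->
  P 0 0 -> (forall e, P 0 e -> e = 0) ->
  (forall c x y x' y', P x y -> P x' y' -> P (c *: x + x') (c *: y + y')) ->
  exists h : {linear Y -> E}, forall y e, P y e -> h y = e.
Proof.
move=> injE P00 P0 Pl.
have Gs : submodule (fun u : (Y * E)%type => P u.1 u.2).
  by split=> // c u v; exact: Pl.
pose G : lmodType R := submod_of (mksubmod Gs).
have l1 : linear (fun u : G => (val u).1) by [].
have l2 : linear (fun u : G => (val u).2) by [].
have [|h hP] := injE _ _ (mklinear l1) (mklinear l2).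
  move=> [[y e] Gu] [[y' e'] Gv] /= yE; rewrite /mklinear /linear_of /= in yE.
  apply: val_inj => /=; rewrite yE; congr (_, _).
  apply/eqP; rewrite -subr_eq0; apply/eqP/P0.
  move: (Gu) (Gv) => /mksubmodP/= Pu /mksubmodP/= Pv.
  have := Pl (-1) _ _ _ _ Pv Pu; rewrite !scaleN1r yE addNr.
  by rewrite addrC.
exists h => y e Pye.
have Gye : (y, e) \in mksubmod Gs by apply/mksubmodP.
exact: (hP (SubmodOf Gye)).
Qed.

Lemma injective_factor X Y E (f : {linear X -> Y}) (g : {linear X -> E}) :
  injective_module E -> (forall x, f x = 0 -> g x = 0) ->
  exists h : {linear Y -> E}, forall x, h (f x) = g x.
Proof.
move=> injE fg.
have [|e [x /esym/fg gx0 ->] //||h hP] :=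
    @injective_extend Y E (fun y e => exists2 x, y = f x & e = g x) injE.
- by exists 0; rewrite linear0.
- move=> c _ _ _ _ [x -> ->] [x' -> ->]; exists (c *: x + x').
    by rewrite linearP.
  by rewrite linearP.
by exists h => x; apply: hP; exists x.
Qed.

Lemma injective_prod X Y :
  injective_module X -> injective_module Y -> injective_module (X * Y)%type.
Proof.
move=> injX injY A B f g finj.
have l1 : linear (fun a => (g a).1) by move=> c x y; rewrite linearP.
have l2 : linear (fun a => (g a).2) by move=> c x y; rewrite linearP.
have [h1 h1P] := injX _ _ f (mklinear l1) finj.
have [h2 h2P] := injY _ _ f (mklinear l2) finj.
have lh : linear (fun b => (h1 b, h2 b)).
  by move=> c x y; rewrite !linearP.
exists (mklinear lh) => x; rewrite [g x]surjective_pairing.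
by congr (_, _); [exact: h1P|exact: h2P].
Qed.

Definition disjoint_submodules E (A B : E -> Prop) :=
  forall x, A x -> B x -> x = 0.

Lemma maximal_disjoint E (T B0 : E -> Prop) :
  submodule T -> submodule B0 -> disjoint_submodules T B0 ->
  exists B, [/\ submodule B, forall x, B0 x -> B x, disjoint_submodules T B &
    forall x, ~ B x -> exists b r, [/\ B b, T (b + r *: x) & b + r *: x <> 0]].
Proof.
move=> Ts B0s TB0.
(* Zorn's lemma is applied to the sets Y whose union with B0 is a submodule
   disjoint from T, so that the empty chain has an upper bound. *)
pose plus (Y : E -> Prop) x := B0 x \/ Y x.
pose P (Y : set E) := submodule (plus Y) /\ disjoint_submodules T (plus Y).
have [F FP Ftot|Y [[Ys TY] Ymax]] := @Zorn_bigcup E P.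
  have FD x y : plus (\bigcup_(Y in F) Y)%classic x ->
      plus (\bigcup_(Y in F) Y)%classic y ->
      (B0 x /\ B0 y) \/ exists2 Y, F Y & plus Y x /\ plus Y y.
    move=> [B0x|[Y FY Yx]] [B0y|[Y' FY' Yy]]; first by left.
    - by right; exists Y' => //; split; [left|right].
    - by right; exists Y => //; split; [right|left].
    - by have [/(_ _ Yx) ?|/(_ _ Yy) ?] := Ftot _ _ FY FY'; right;
        [exists Y'|exists Y] => //; split; right.
  split; first split.
  - by left; exact: submodule0.
  - move=> c x y Ux Uy; have [[Bx By]|[Y FY [Yx Yy]]] := FD x y Ux Uy.
      by left; case: B0s => _; apply.
    have [[_ Pl] _] := FP _ FY.
    by case: (Pl c x y Yx Yy) => [|Yxy]; [left|right; exists Y].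
  - move=> x Tx [/(TB0 _ Tx) //|[Y FY Yx]].
    by have [_ ] := FP _ FY; apply=> //; right.
exists (plus Y); split=> [//|x B0x|//|x nYx]; first by left.
apply: contrapT => nobr.
pose Y' z := exists b r, plus Y b /\ z = b + r *: x.
have Y'Y z : plus Y z -> Y' z.
  by move=> Yz; exists z, 0; rewrite scale0r addr0.
have plusY' : plus Y' = Y'.
  apply: funext => z; apply: propext; split=> [[B0z|//]|]; last by right.
  by apply: Y'Y; left.
apply: (Ymax Y'); first split.
- by move=> z Yz; apply: Y'Y; right.
- move=> Y'sub; apply: nYx; right; apply: Y'sub.
  by exists 0, 1; rewrite scale1r add0r; split=> //; exact: submodule0.
rewrite /P plusY'; split.
  split=> [|c _ _ [b [r [Yb ->]]] [b' [r' [Yb' ->]]]].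
    by apply: Y'Y; exact: submodule0.
  exists (c *: b + b'), (c * r + r'); split; first by case: Ys => _; apply.
  by rewrite scalerDr scalerDl addrACA scalerA.
move=> z Tz [b [r [Yb zE]]]; apply: contrapT => z0; apply: nobr; exists b, r.
by rewrite -zE; split.
Qed.

(** Every submodule T of an injective module E is essential in a direct
    summand of E, which may be taken disjoint from any given submodule B0
    disjoint from T; h is the projection onto that summand.  For B maximal
    disjoint from T and A maximal disjoint from B, the extension to E of the
    projection of A + B onto A has kernel B by the choice of B and image A by
    the choice of A. *)
Lemma injective_summand E (T B0 : E -> Prop) : injective_module E ->
  submodule T -> submodule B0 -> disjoint_submodules T B0 ->
  exists h : {linear E -> E}, [/\ forall x, T x -> h x = x,
    forall x, B0 x -> h x = 0, forall x, h (h x) = h x &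
    forall x, h x <> 0 -> exists r, T (r *: h x) /\ r *: h x <> 0].
Proof.
move=> injE Ts B0s TB0.
have [B [Bs B0B TB Bmax]] := maximal_disjoint Ts B0s TB0.
have BT : disjoint_submodules B T by move=> x Bx Tx; exact: TB.
have [A [As TA BA Amax]] := maximal_disjoint Bs Ts BT.
have [|e [Ae]||h hP] := @injective_extend E E (fun y e => A e /\ B (y - e)) injE.
- by rewrite subr0; split; exact: submodule0.
- rewrite sub0r => Be; apply: BA => //; rewrite -[e]opprK.
  exact: submoduleN.
- move=> c x y x' y' [Ay Bxy] [Ay' Bxy']; split.
    by case: As => _; apply.
  by rewrite opprD addrACA -scalerBr; case: Bs => _; apply.
have hA x : A x -> h x = x.
  by move=> Ax; apply: hP; rewrite subrr; split=> //; exact: submodule0.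
have hB x : B x -> h x = 0.
  by move=> Bx; apply: hP; rewrite subr0; split=> //; exact: submodule0.
have kerB x : h x = 0 -> B x.
  move=> hx0; apply: contrapT => /Bmax[b [r [Bb Tbrx]]]; apply.
  by rewrite -(hA _ (TA _ Tbrx)) linearD linearZ /= hx0 (hB _ Bb) scaler0 addr0.
have imB x : B (h x) -> h x = 0.
  move=> Bhx; apply: contrapT => hx0.
  have /Bmax[b [r [Bb Tbrx]]] : ~ B x by move/hB.
  apply; apply: TB => //; rewrite -(hA _ (TA _ Tbrx)).
  by rewrite linearD linearZ /= (hB _ Bb) add0r; exact: submoduleZ.
have imA x : A (h x).
  apply: contrapT => /Amax[b [r [Ab Bbr]]]; apply.
  move: Bbr; rewrite -(hA _ Ab) -linearZ -linearD; exact: imB.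
exists h; split=> [x /TA/hA //|x /B0B/hB //|x|x hx0]; first exact/hA/imA.
have /Bmax[b [r [Bb Tbrx brx0]]] : ~ B (h x).
  by move/imB.
exists r; suff -> : r *: h x = b + r *: h x by [].
by rewrite -(hA _ (TA _ Tbrx)) linearD (hB _ Bb) add0r linearZ /= (hA (h x)).
Qed.

(** An indecomposable injective module is uniform: if R x and R y were disjoint,
    the summand in which R x is essential could be chosen disjoint from R y. *)
Lemma indecomposable_uniform E : injective_module E -> indecomposable_module E ->
  forall x y : E, x <> 0 -> y <> 0 -> exists r s, r *: x = s *: y /\ r *: x <> 0.
Proof.
move=> injE [_ indec] x y x0 y0; apply: contrapT => nors.
have span_submodule (z : E) : submodule (fun u => exists r, u = r *: z).
  split=> [|c _ _ [r ->] [s ->]]; first by exists 0; rewrite scale0r.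
  by exists (c * r + s); rewrite scalerDl scalerA.
have [|h [hx hy hh _]] :=
    injective_summand injE (span_submodule x) (span_submodule y).
  move=> _ [r ->] [s rsE]; apply: contrapT => rx0; apply: nors.
  by exists r, s.
have fixs : submodule (fun u => h u = u).
  by split=> [|c u v hu hv]; rewrite ?linear0 // linearP hu hv.
have kers : submodule (fun u => h u = 0).
  by split=> [|c u v hu hv]; rewrite ?linear0 // linearP hu hv scaler0 addr0.
have [u|u /mksubmodP/= <- /mksubmodP/=|A0|B0] := indec (mksubmod fixs) (mksubmod kers).
- exists (h u), (u - h u); split; first by apply/mksubmodP.
    by apply/mksubmodP; rewrite linearB hh subrr.
  by rewrite addrC subrK.
- by rewrite hh.
- by apply: x0; apply: A0; apply/mksubmodP/hx; exists 1; rewrite scale1r.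
- by apply: y0; apply: B0; apply/mksubmodP/hy; exists 1; rewrite scale1r.
Qed.

End Injectives.

(** * Torsion with respect to an ideal *)

Section TorsionElements.
Local Open Scope ring_scope.
Variables (R : comPzRingType) (a : ideal R).
Implicit Types X Y E : lmodType R.

(** The a-torsion of X / N, pulled back to X.  For N = 0 it is the torsion
    submodule Gamma_a(X) when a is finitely generated; asking for the
    nilpotency of one element of a at a time makes it stable under iteration
    for free. *)
Definition tors_mod X (N : X -> Prop) (x : X) :=
  forall r, r \in a -> exists n, N (r ^+ n *: x).

Definition tors X := @tors_mod X (fun x => x = 0).

Lemma submodule_eq0 X : submodule (fun x : X => x = 0).
Proof. by split=> // c x y -> ->; rewrite scaler0 addr0. Qed.

Lemma submodule_pow_le X (N : X -> Prop) (r : R) (x : X) m n : submodule N ->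
  (m <= n)%N -> N (r ^+ m *: x) -> N (r ^+ n *: x).
Proof.
by move=> Ns /subnK <- Nx; rewrite exprD -scalerA; exact: submoduleZ.
Qed.

Lemma tors_mod_submodule X (N : X -> Prop) :
  submodule N -> submodule (tors_mod N).
Proof.
move=> Ns; split=> [|c x y xt yt] r ra.
  by exists 0%N; rewrite scaler0; exact: submodule0.
have [[m Nx] [n Ny]] := (xt r ra, yt r ra); exists (maxn m n).
rewrite scalerDr scalerA mulrC -scalerA; case: (Ns) => _; apply.
  exact: submodule_pow_le (leq_maxl _ _) Nx.
exact: submodule_pow_le (leq_maxr _ _) Ny.
Qed.

Lemma sub_tors_mod X (N : X -> Prop) x : N x -> tors_mod N x.
Proof. by move=> Nx r _; exists 0%N; rewrite expr0 scale1r. Qed.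

Lemma tors_mod_closed X (N : X -> Prop) x :
  (forall r, r \in a -> exists n, tors_mod N (r ^+ n *: x)) -> tors_mod N x.
Proof.
move=> xt r ra; have [n /(_ r ra)[m Nx]] := xt r ra.
by exists (m + n)%N; rewrite exprD -scalerA.
Qed.

Lemma tors_submodule X : submodule (@tors X).
Proof. exact/tors_mod_submodule/submodule_eq0. Qed.

Lemma tors_linear X Y (f : {linear X -> Y}) x : tors x -> tors (f x).
Proof.
move=> xt r /xt[n rx0]; exists n.
by rewrite -linearZ rx0 linear0.
Qed.

Hypothesis noethR : noetherian_ring R.

(** Noetherian induction on the annihilator of a multiple z of x: some power of
    a kills each t z with t among finitely many generators of a. *)
Lemma torsion_predP X (x : X) : x \in torsion_pred a X <-> tors x.
Proof.
split=> [/asboolP[n xP] r ra|xt].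
  exists n; apply: xP; elim: n => [//|n IHn].
  exists [:: (r, r ^+ n)]; last by rewrite big_seq1 exprS.
  by move=> _ /[1!inE] /eqP ->.
apply: contrapT => nx.
pose bad I := exists c, ~ (c *: x \in torsion_pred a X) /\
  I = (fun r => r *: (c *: x) = 0).
have [I [[c [nc ->]] _ Imax]] : exists I, [/\ bad I,
    forall r, r *: (1 *: x) = 0 -> I r &
    forall J, bad J -> (forall r, I r -> J r) -> forall r, J r -> I r].
  apply: noetherian_max => //; first by move=> _ [c [_ ->]]; exact: ann_ideal.
  by exists 1; rewrite scale1r.
have ct : tors (c *: x) by exact: (submoduleZ c (tors_submodule X)).
have step t : t \in a -> t *: (c *: x) \in torsion_pred a X.
  move=> ta; have [n tn0] := ct t ta; apply: contrapT => nt.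
  elim: n tn0 => [|n IHn] tn0.
    by apply: nc; rewrite -[_ *: _]scale1r -(expr0 t) tn0 rpred0.
  apply: IHn; apply: (Imax (fun r => r *: (t *: (c *: x)) = 0)).
  - by exists (t * c); rewrite -scalerA.
  - by move=> r rc0; rewrite scalerA mulrC -scalerA rc0 scaler0.
  - by rewrite scalerA -exprSr.
have [s [sa sP]] := ideal_fg noethR (submodule_mem a).
have [N NP] : exists N, forall t, t \in s ->
    forall r, ideal_exp a N r -> r *: (t *: (c *: x)) = 0.
  elim: s sa {sP} => [|t s IHs] sa; first by exists 0%N.
  have [|N NP] := IHs; first by move=> u us; apply: sa; rewrite inE us orbT.
  have /step/asboolP[M MP] := sa t (mem_head t s).
  exists (maxn M N) => u; rewrite in_cons => /orP[/eqP ->|us] r rMN.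
    exact/MP/(ideal_exp_le (leq_maxl M N)).
  exact/NP/(ideal_exp_le (leq_maxr M N)).
apply: nc; apply/asboolP; exists N.+1 => _ [l lP ->].
rewrite scaler_suml big1_seq // => -[u v] /= /lP[/= ua va].
rewrite mulrC -scalerA; apply: (sP (fun u => v *: (u *: (c *: x)) = 0)) => //.
  split=> [|d y z y0 z0]; first by rewrite scale0r scaler0.
  by rewrite scalerDl scalerDr z0 addr0 -scalerA scalerA mulrC -scalerA y0 scaler0.
by move=> t /NP; apply.
Qed.

(** Gamma_a(E) is a direct summand of an injective module E: by
    [nilpotent_essential] an essential extension of a torsion module is
    torsion. *)
Lemma torsion_summand E : injective_module E -> exists h : {linear E -> E},
  (forall x, tors x -> h x = x) /\ forall x, tors (h x).
Proof.
move=> injE.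
have [|h [ht _ _ hess]] := injective_summand injE (tors_submodule E) (submodule_eq0 E).
  by move=> x _ ->.
exists h; split=> // x r ra; apply: (nilpotent_essential noethR) => s.
rewrite -linearZ /= => /eqP /hess[s' [st st0]].
have [n rn0] := st r ra; exists s', n; split=> //; exact/eqP.
Qed.

End TorsionElements.

Section UniformSummands.
Local Open Scope ring_scope.
Variable R : comPzRingType.
Hypothesis noethR : noetherian_ring R.

(** The injective envelope F of R / p, for a maximal ideal p: every element of
    p is locally nilpotent on F, and (0 : p) = R e is simple, so Melkersson's
    criterion applies to the generators of p one after the other. *)
Lemma dcc_uniform (E : lmodType R) (F : E -> Prop) (e : E) (p : R -> Prop) :
  submodule F -> submodule (p : R^o -> Prop) ->
  (forall r, p r <-> r *: e = 0) ->
  (forall r, ~ p r -> exists r', p (r' * r - 1)) ->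
  (forall y, F y -> y <> 0 -> exists r r', r *: y = r' *: e /\ r *: y <> 0) ->
  dcc_between (fun y => y = 0) F.
Proof.
move=> Fs ps pe pmax ess.
have nil t y : p t -> F y -> exists n, t ^+ n *: y = 0.
  move=> pt Fy; apply: (nilpotent_essential noethR) => r /eqP ry0.
  have [|s [r' [sE s0]]] := ess (r *: y) _ ry0; first exact: submoduleZ.
  exists s, 1%N; split; first exact/eqP.
  by rewrite expr1 sE scalerA mulrC -scalerA (pe t).1 ?scaler0.
have [s [sp sP]] := ideal_fg noethR ps.
have socle y : F y -> (forall t, t \in s -> t *: y = 0) -> exists r, y = r *: e.
  move=> Fy sy0; have py0 t : p t -> t *: y = 0.
    by apply: (sP (fun t => t *: y = 0)) => //; exact: ann_ideal.
  have [->|/eqP y0] := eqVneq y 0; first by exists 0; rewrite scale0r.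
  have [r [r' [rE r0]]] := ess y Fy y0.
  have [u pu] : exists u, p (u * r - 1) by apply: pmax => /py0.
  exists (u * r'); rewrite -scalerA -rE scalerA.
  by apply/esym/eqP; rewrite -subr_eq0 -{2}[y]scale1r -scalerBl py0.
have simple : dcc_between (fun y => y = 0) (fun y => exists r, y = r *: e).
  move=> N Ns Nd N0 Ne; have [eN|/existsNP[i Nie]] := EM (forall i, N i e).
    by exists 0%N => m _ x /Ne[r ->]; exact: submoduleZ.
  exists i => m _ x Nx; have [r xE] := Ne _ _ Nx.
  have [->|x0] := eqVneq x 0; first exact: submodule0.
  exfalso; apply: Nie; have [u pu] : exists u, p (u * r - 1).
    by apply: pmax => /pe re0; rewrite xE re0 eqxx in x0.
  have /eqP : (u * r - 1) *: e = 0 by exact/pe.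
  rewrite scalerBl scale1r subr_eq0 -scalerA -xE => /eqP <-.
  exact: submoduleZ.
have : dcc_between (fun y => y = 0) (fun y => F y /\ forall t, t \in s -> t *: y = 0).
  by apply: dcc_mono simple => // y [Fy] /socle; apply.
elim: s sp {sP socle} => [_|t s IHs sp dccs].
  by apply: dcc_mono.
apply: IHs; first by move=> u us; apply: sp; rewrite inE us orbT.
apply: (@dcc_locally_nilpotent _ _ _ _ t).
- exact: submodule_eq0.
- split=> [|c x y [Fx xs] [Fy ys]].
    by split=> [|u _]; [exact: submodule0|rewrite scaler0].
  split; first by case: Fs => _; apply.
  by move=> u us; rewrite scalerDr scalerA mulrC -scalerA xs // ys // scaler0 addr0.
- by move=> x ->; split=> [|u _]; [exact: submodule0|rewrite scaler0].
- by move=> z [Fz _]; apply: nil => //; exact/sp/mem_head.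
apply: dcc_mono dccs => // y [[Fy ys] ty0]; split=> // u.
by rewrite in_cons => /orP[/eqP ->|/ys].
Qed.

End UniformSummands.

(** * Modules of finite relative Goldie dimension *)

Section Projections.
Local Open Scope ring_scope.
Local Open Scope quotient_scope.
Variables (R : comPzRingType) (M : lmodType R) (N : submodClosed M).

Lemma pi_quotmod_linear : linear (\pi_(quotmod N) : M -> quotmod N).
Proof. by move=> c x y; rewrite pi_quotmodD pi_quotmod_scale. Qed.

Definition quotmod_proj : {linear M -> quotmod N} := mklinear pi_quotmod_linear.

Lemma quotmod_proj_eq0 x : quotmod_proj x = 0 <-> x \in N.
Proof.
rewrite -[x in x \in N]subr0 -eq_quotmod -(linear0 quotmod_proj).
by split=> [/eqP|/eqP].
Qed.

Lemma quotmod_proj_surj y : exists x, quotmod_proj x = y.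
Proof. by exists (repr y); exact: reprK. Qed.

End Projections.

Section PrimeIdeals.
Local Open Scope ring_scope.
Variable R : comPzRingType.

Lemma prime_idealP (p : ideal R) :
  prime_ideal p <-> primep (fun r => r \in p).
Proof.
split=> [[p1 pM]|[p1 pM]]; split.
- exact/negP.
- by move=> x y /pM/orP.
- exact/negP.
- by move=> x y /pM/orP.
Qed.

Lemma prime_ideal_mksubmod (I : R -> Prop) (Is : submodule (I : R^o -> Prop)) :
  primep I -> prime_ideal (mksubmod Is : ideal R).
Proof.
move=> [I1 IM]; apply/prime_idealP; split; first by move/mksubmodP.
by move=> x y /mksubmodP/IM[]; [left|right]; apply/mksubmodP.
Qed.

End PrimeIdeals.

Section FiniteGoldieDimension.
Local Open Scope ring_scope.
Variables (R : comPzRingType) (a : ideal R) (X : lmodType R).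
Hypothesis noethR : noetherian_ring R.

(** If p + R r were proper, it would lie in a prime ideal, strictly larger
    than p. *)
Lemma prime_inverse (p : ideal R) : prime_ideal p ->
  (forall q : ideal R, prime_ideal q -> {subset p <= q} -> {subset q <= p}) ->
  forall r : R, r \notin p -> exists r', r' * r - 1 \in p.
Proof.
move=> pp pmax r rp; apply: contrapT => nor.
pose I x := exists y c, y \in p /\ x = y + c * r.
have Is : submodule (I : R^o -> Prop).
  split=> [|d _ _ [y [c [py ->]]] [z [e [pz ->]]]].
    by exists 0, 0; rewrite mul0r addr0 rpred0.
  exists (d *: (y : R^o) + z), (d * c + e); split; first by rewrite rpredD ?rpredZ.
  by rewrite /GRing.scale /= mulrDr mulrDl addrACA mulrA.
have [||q [qs qp Iq _]] := prime_avoiding noethR (S := fun x => x = 1) Is erefl.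
- by move=> _ _ -> ->; rewrite mulr1.
- move=> x Ix x1; move: Ix; rewrite x1 => -[y [c [py yE]]]; apply: nor.
  by exists c; rewrite {}yE opprD addrCA subrr addr0 (rpredN (submod_zmod p)).
have rq : r \in (mksubmod qs : ideal R).
  by apply/(mksubmodP qs)/Iq; exists 0, 1; rewrite mul1r add0r rpred0.
move/negP: rp; apply.
apply: (pmax (mksubmod qs)) rq; first exact: prime_ideal_mksubmod.
move=> x px; apply/(mksubmodP qs)/Iq; exists x, 0; by rewrite mul0r addr0.
Qed.

(** If the primes of V(a) in the support of X are maximal, then Gamma_a(X)
    embeds into the direct sum of the summands E(R / p) of E(X) with p in
    V(a): there are finitely many of them, each Artinian. *)
Lemma dcc_torsion : finite_Gdim a X ->
  (forall p q : ideal R, prime_ideal p -> prime_ideal q -> {subset a <= p} ->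
    (exists x : X, forall s, s \notin p -> s *: x <> 0) ->
    {subset p <= q} -> {subset q <= p}) ->
  dcc_between (fun x : X => x = 0) (tors a (X := X)).
Proof.
move=> [E [iota [D [[injE [iota_inj iota_ess]] finD]]]] pmax.
pose F (j : dec_index D) (e : E) := e \in dec_summand j.
have Fs j : submodule (F j) by exact: submodule_mem.
have dccF p j : Gdim D a (p, j) -> dcc_between (fun y => y = 0) (F j).
  move=> [/= pp ap [io [injF [io_inj io_ess]]]].
  (* e spans the image of R / p in the summand F j. *)
  pose e : E := val (io (quotmod_proj p 1)).
  have eE r : r *: e = val (io (quotmod_proj p r)).
    have -> : quotmod_proj p r = r *: quotmod_proj p 1.
      by rewrite -linearZ /=; congr (quotmod_proj p _); rewrite [RHS]mulr1.
    by rewrite linearZ.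
  have pe r : r \in p <-> r *: e = 0.
    rewrite eE -quotmod_proj_eq0; split=> [->|v0]; first by rewrite !linear0.
    by apply: io_inj; apply: val_inj; rewrite [LHS]v0 !linear0.
  have Fe : F j e by exact: valP.
  have Fess y : F j y -> y <> 0 ->
      exists r r', r *: y = r' *: e /\ r *: y <> 0.
    move=> Fy y0; have sy : submodule (fun u : submod_of (dec_summand j) =>
        exists r, val u = r *: y).
      split=> [|c u v [r uE] [s vE]]; first by exists 0; rewrite scale0r linear0.
      exists (c * r + s); rewrite scalerDl -scalerA -uE -vE.
      by rewrite linearD linearZ.
    have [|u] := io_ess (mksubmod sy).
      exists (SubmodOf Fy); first by apply/mksubmodP; exists 1; rewrite scale1r.
      by apply/eqP => /(congr1 val).
    move=> /mksubmodP[r rE] /eqP u0; have [s sE] := quotmod_proj_surj u.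
    exists r, s; rewrite -rE eE sE; split=> // ru0; apply: u0.
    by apply: val_inj; rewrite ru0 linear0.
  (* By essentiality R e meets X, hence p annihilates an element of X. *)
  have psupp : exists x : X, forall s, s \notin p -> s *: x <> 0.
    have se : submodule (fun u : E => exists r, u = r *: e).
      split=> [|c _ _ [r ->] [s ->]]; first by exists 0; rewrite scale0r.
      by exists (c * r + s); rewrite scalerDl scalerA.
    have [|x /mksubmodP[r rE] x0] := iota_ess (mksubmod se).
      exists e; first by apply/mksubmodP; exists 1; rewrite scale1r.
      apply/eqP => e0; case: (pp) => /negP + _; apply.
      by apply/pe; rewrite scale1r.
    exists x => s sp sx0; have : (s * r) \in p.
      by apply/pe; rewrite -scalerA -rE -linearZ /= sx0 linear0.
    case: (pp) => _ pM /pM; rewrite (negbTE sp) => /pe.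
    by rewrite -rE => x0'; rewrite x0' eqxx in x0.
  apply: (@dcc_uniform _ noethR _ _ e (fun r => r \in p)) => //.
    exact: submodule_mem.
  move=> r /negP rp; apply: prime_inverse => //.
  by move=> q qp; exact: pmax.
have [s sP] : exists s : seq (dec_index D), forall j,
    (exists p, Gdim D a (p, j)) -> j \in s.
  have /finite_seqP[s sE] := finite_image snd finD.
  exists s => j [p pj].
  have : [set` s]%classic j by rewrite -sE; exists (p, j).
  by [].
pose span (s : seq (dec_index D)) (e : E) := forall Q : E -> Prop,
  submodule Q -> (forall j, j \in s -> forall x, F j x -> Q x) -> Q e.
have dccs : dcc_between (fun y => y = 0)
    (span [seq j <- s | `[< exists p, Gdim D a (p, j) >]]).
  elim: s {sP} => [|j s IHs] /=.
    move=> N Ns _ _ N0; exists 0%N => m _ x /N0 sx.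
    have -> : x = 0 by apply: (sx (fun z => z = 0)) => //; exact: submodule_eq0.
    exact: submodule0.
  case: asboolP => [[p pj]|_ //].
  set t := [seq _ <- s | _] in IHs *.
  have ts : submodule (span t).
    split=> [Q Qs _|c x y sx sy Q Qs QF]; first exact: submodule0.
    by case: (Qs) => _; apply; [exact: sx|exact: sy].
  apply: dcc_mono (dcc_add (Fs j) ts (dccF _ _ pj) IHs) => // e se.
  apply: (se (fun x => exists u v, [/\ F j u, span t v & x = u + v])).
    split=> [|c _ _ [x [y [Fx ty ->]]] [x' [y' [Fx' ty' ->]]]].
      exists 0, 0; rewrite addr0.
      by split=> //; [exact: (submodule0 (Fs j))|exact: (submodule0 ts)].
    exists (c *: x + x'), (c *: y + y').
    split; [by case: (Fs j) => _; apply|by case: ts => _; apply|].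
    by rewrite scalerDr addrACA.
  move=> i; rewrite in_cons => /orP[/eqP ->|it] x Fx.
    by exists x, 0; rewrite addr0; split=> //; exact: (submodule0 ts).
  exists 0, x; rewrite add0r; split=> //; first exact: (submodule0 (Fs j)).
  by move=> Q Qs QF; exact: QF Fx.
have ts : submodule (span [seq j <- s | `[< exists p, Gdim D a (p, j) >]]).
  split=> [Q Qs _|c x y sx sy Q Qs QF]; first exact: submodule0.
  by case: (Qs) => _; apply; [exact: sx|exact: sy].
apply: (@dcc_transfer _ _ _ (fun x e => iota x = e)) dccs => //.
- exact: linear0.
- by move=> c x _ x' _ <- <-; rewrite linearP.
- exact: submodule_eq0.
- by move=> _ ->; exact: submodule0.
- move=> x xt; exists (iota x) => // Q Qs QF.
  have [ls [f [Ff iE]]] := (dec_direct_sum D).1 (iota x).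
  (* The summands may be indexed with repetitions; collect them. *)
  pose g j := f j *+ count_mem j ls.
  have Fg j : F j (g j) by exact: rpredMn.
  have {}iE : iota x = \sum_(j <- undup ls) g j.
    rewrite iE -big_undup_iterop_count; exact: eq_bigr.
  have gt j : j \in undup ls -> tors a (g j).
    move=> jl r ra; have [n rn0] := xt r ra; exists n.
    apply: ((dec_direct_sum D).2 (undup ls) (fun j => r ^+ n *: g j)) jl.
    - exact: undup_uniq.
    - by move=> i; exact/rpredZ/Fg.
    - by rewrite -scaler_sumr -iE -linearZ rn0 linear0.
  rewrite iE big_seq; apply: big_ind => [|u v|j jl].
  + exact: submodule0.
  + exact: submoduleD.
  have [->|gj0] := eqVneq (g j) 0; first exact: submodule0.
  apply: (QF j _ _ (Fg j)).
  (* An associated prime p of R (g j) contains a since g j is torsion, and the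
     summand, being uniform, is an injective envelope of R / p. *)
  have gjs : exists p, Gdim D a (p, j).
    pose y : submod_of (dec_summand j) := SubmodOf (Fg j).
    have y0 : y != 0 by apply: contra_neq gj0 => /(congr1 val).
    have [r [ry0 rp]] := associated_prime noethR y0.
    pose ps := ann_ideal (r *: y); pose p : ideal R := mksubmod ps.
    have pp : prime_ideal p by exact: prime_ideal_mksubmod.
    exists p; split=> //=.
      move=> t ta; have [n tn0] := gt j jl t ta.
      apply/(mksubmodP ps)/(@primeX _ _ _ n rp).
      rewrite scalerA mulrC -scalerA; suff -> : t ^+ n *: y = 0 by rewrite scaler0.
      by apply: val_inj; rewrite linearZ /= tn0.
    have [||c u v u' v' [s1 -> ->] [s2 -> ->]|io ioP] := @linear_from_relation _
        (quotmod p) _ (fun u v => exists2 s, u = quotmod_proj p s & v = s *: (r *: y)).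
    - by move=> u; have [s' <-] := quotmod_proj_surj u; exists (s' *: (r *: y)), s'.
    - by move=> v [s' /esym/quotmod_proj_eq0/(mksubmodP ps) + ->].
    - exists (c *: s1 + s2); rewrite ?linearP //.
      by rewrite scalerDl -scalerA.
    have io0 u : io u = 0 -> u = 0.
      have [s' uE vE] := ioP u; rewrite vE => s0.
      by rewrite uE; apply/quotmod_proj_eq0/(mksubmodP ps).
    exists io; split; first exact: dec_injective.
    split=> [u v uv|N [z zN /eqP z0]].
      apply/eqP; rewrite -subr_eq0; apply/eqP/io0.
      by rewrite linearB uv subrr.
    have ry0' : r *: y <> 0 by apply/eqP.
    have [s1 [s2 [s12 s0]]] := indecomposable_uniform
      (@dec_injective _ _ D j) (@dec_indecomposable _ _ D j) z0 ry0'.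
    exists (quotmod_proj p s2); last first.
      apply/eqP => /io0/quotmod_proj_eq0/(mksubmodP ps) s20.
      by apply: s0; rewrite s12.
    have [s' /eqP + ->] := ioP (quotmod_proj p s2).
    rewrite -subr_eq0 -linearB => /eqP/quotmod_proj_eq0/(mksubmodP ps) /eqP.
    by rewrite scalerBl subr_eq0 => /eqP <-; rewrite -s12 rpredZ.
  by rewrite mem_filter sP // andbT; apply/asboolP.
- by move=> x e _ <-; rewrite -(linear0 iota) => /iota_inj.
Qed.

End FiniteGoldieDimension.

(** * Regular elements and dimension *)

Section RegularElement.
Local Open Scope ring_scope.
Variables (R : comPzRingType) (a : ideal R) (M : lmodType R).

(** Prime avoidance: a is contained in no associated prime of M / L when M / L
    is a-torsion-free. *)
Lemma ZD_regular_element (L : M -> Prop) : ZD_module M -> submodule L ->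
  (forall m, tors_mod a L m -> L m) ->
  exists2 x, x \in a & forall m, L (x *: m) -> L m.
Proof.
move=> zdM Ls Ltf; have [F [finF FA zdE]] := zdM (mksubmod Ls).
have /finite_seqP[s sE] : @finite_set {classic (ideal R)} F by [].
have Fs p : p \in s -> F p by move=> ps; rewrite sE.
have [|p /Fs/FA[/prime_idealP pp _]|p /Fs/FA[pp [y pE]]|x xa xF] :=
    @prime_avoidance R {classic (ideal R)} (fun r => r \in a)
      (fun p r => r \in (p : ideal R)) s.
- exact: submodule_mem.
- by split=> //; exact: submodule_mem.
- apply: contrapT => nx; case: (pp) => /negP + _; apply.
  have [m mE] := quotmod_proj_surj y; rewrite pE scale1r -mE; apply/eqP.
  apply/quotmod_proj_eq0/mksubmodP/Ltf => r ra.
  exists 1%N; rewrite expr1; apply/(mksubmodP Ls)/quotmod_proj_eq0.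
  rewrite linearZ /= mE; apply/eqP; rewrite -pE.
  by apply: contrapT => rp; apply: nx; exists r.
exists x => // m Lxm; apply/(mksubmodP Ls)/quotmod_proj_eq0.
apply/eqP; apply: contraT => m0.
have : zero_divisors (quotmod (mksubmod Ls)) x.
  exists (quotmod_proj (mksubmod Ls) m) => //.
  by rewrite -linearZ; apply/quotmod_proj_eq0/(mksubmodP Ls).
rewrite zdE => -[p Fp xp]; exfalso; apply: (xF p) => //.
by move: Fp; rewrite sE.
Qed.

End RegularElement.

Section Dimension.
Local Open Scope ring_scope.
Variables (R : comPzRingType) (a : ideal R) (M : lmodType R).
Implicit Types (N : M -> Prop) (p q : ideal R).

Definition supp_mod N p :=
  prime_ideal p /\ exists m, forall s, s \notin p -> ~ N (s *: m).

Definition dim_mod_le N d := forall n (c : nat -> ideal R),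
  (forall i, (i <= n)%N -> supp_mod N (c i)) ->
  (forall i, (i < n)%N -> {subset c i <= c i.+1} /\ ~ {subset c i.+1 <= c i}) ->
  (n <= d)%N.

Lemma dim_mod_sub N N' d : (forall m, N m -> N' m) ->
  dim_mod_le N d -> dim_mod_le N' d.
Proof.
move=> NN' Nd n c cN; apply: Nd => i /cN[cp [m mP]]; split=> //.
by exists m => s /mP + /NN'; apply.
Qed.

(** If x is regular on M / N, any prime of Supp (M / (N + x M)) strictly
    contains a prime of Supp (M / N): one avoiding the powers of x. *)
Lemma dim_mod_regular N N' x d : noetherian_ring R -> submodule N ->
  (forall m, N m -> N' m) -> (forall m, N' (x *: m)) ->
  (forall m, N (x *: m) -> N m) -> dim_mod_le N d.+1 -> dim_mod_le N' d.
Proof.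
move=> noethR Ns NN' xN' xreg Nd n c cN' cS.
have [c0p [m mP]] := cN' 0%N (leq0n n).
have regX k y : N (x ^+ k *: y) -> N y.
  elim: k => [|k IHk]; first by rewrite expr0 scale1r.
  by rewrite exprS -scalerA => /xreg/IHk.
pose S r := exists s k, s \notin c 0%N /\ r = s * x ^+ k.
have c01 : (1 : R) \notin c 0%N by case: c0p.
have [|_ _ [s [k [sc ->]]] [t [l [tc ->]]]|r Nr [s [k [sc rE]]]|q [qs qp Iq qS]] :=
    prime_avoiding noethR (S := S) (colon_ideal m Ns).
- by exists 1, 0%N; rewrite expr0 mulr1.
- exists (s * t), (k + l)%N; rewrite exprD mulrACA; split=> //.
  by apply: contra sc => /c0p.2; rewrite (negbTE tc) orbF.
- apply: (mP s) => //; apply/NN'/(regX k).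
  by rewrite scalerA mulrC -rE.
pose Q : ideal R := mksubmod qs.
pose c' i := if i is j.+1 then c j else Q.
suff : (n.+1 <= d.+1)%N by [].
apply: (Nd _ c') => -[_|i].
- split; first exact: prime_ideal_mksubmod.
  by exists m => s /negP sQ Nsm; apply: sQ; apply/(mksubmodP qs)/Iq.
- rewrite ltnS => /cN'[cp [y yP]]; split=> //.
  by exists y => s /yP + /NN'; apply.
- split=> /= [r /(mksubmodP qs) /qS Sr|cQ].
    by apply: contraT => rc; exfalso; apply: Sr; exists r, 0%N; rewrite mulr1.
  have /cQ/(mksubmodP qs)/qS : x \in c 0%N.
    by apply: contraT => /mP; case.
  by apply; exists 1, 1%N; rewrite mul1r expr1.
- exact: cS.
Qed.

(** The two alternative dimension hypotheses; the first concerns a alone and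
    hence does not depend on N. *)
Definition small_dim N d :=
  (forall p q, prime_ideal p -> prime_ideal q -> {subset a <= p} ->
     {subset p <= q} -> {subset q <= p}) \/ dim_mod_le N d.

Lemma small_dim0_maximal N p q : small_dim N 0 -> prime_ideal p ->
  prime_ideal q -> {subset a <= p} ->
  (exists m, forall s, s \notin p -> ~ N (s *: m)) ->
  {subset p <= q} -> {subset q <= p}.
Proof.
move=> [pmax|Nd] pp qp ap [m mP] pq; first exact: pmax.
apply: contrapT => nqp.
suff : (1 <= 0)%N by [].
apply: (Nd _ (fun i => if i is 0 then p else q)) => -[|i] // _.
  by split=> //; exists m.
split=> //; exists m => s sq; apply: mP; apply: contra sq; exact: pq.
Qed.

Lemma dcc_tors_mod (N : submodClosed M) : noetherian_ring R ->
  finite_Gdim a (quotmod N) -> small_dim (fun m => m \in N) 0 ->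
  dcc_between (fun m => m \in N) (tors_mod a (fun m => m \in N)).
Proof.
move=> noethR finN Nd.
have Hdcc := dcc_torsion noethR finN.
have {}Hdcc : dcc_between (fun y : quotmod N => y = 0) (tors a (X := _)).
  apply: Hdcc => p q pp qp ap [y yP] pq; apply: (small_dim0_maximal Nd) => //.
  have [m mE] := quotmod_proj_surj y; exists m => s /yP + sm.
  by apply; rewrite -mE -linearZ; apply/quotmod_proj_eq0.
apply: (@dcc_transfer _ _ _ (fun m y => quotmod_proj N m = y)) Hdcc.
- exact: linear0.
- by move=> c x _ x' _ <- <-; rewrite linearP.
- exact: submodule_eq0.
- exact: tors_submodule.
- by move=> _ ->; exact: submodule0 (tors_submodule _ _).
- move=> m mt; exists (quotmod_proj N m) => // r /mt[n rN].
  by exists n; rewrite -linearZ; apply/quotmod_proj_eq0.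
- by move=> m _ _ <- /quotmod_proj_eq0.
Qed.

End Dimension.

(** * Complexes of injective modules *)

Section Complexes.
Local Open Scope ring_scope.
Variable R : comPzRingType.
Implicit Types C : cochain_complex R.

Definition cprev C n : lmodType R := if n is m.+1 then C m else 'rV[R]_0.

Definition dprev C n : {linear cprev C n -> C n} :=
  match n return {linear cprev C n -> C n} with
  | 0 => \0
  | m.+1 => diff C m
  end.

Definition boundary C n (u : C n) := exists v, dprev C n v = u.

Lemma boundary_submodule C n : submodule (@boundary C n).
Proof.
split=> [|c _ _ [u <-] [v <-]]; first by exists 0; rewrite linear0.
by exists (c *: u + v); rewrite linearP.
Qed.

Lemma diff_dprev C n v : diff C n (dprev C n v) = 0.
Proof. by case: n v => [v|n v] /=; rewrite ?linear0 ?diffK. Qed.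

Lemma injective_cprev C n :
  (forall n, injective_module (C n)) -> injective_module (cprev C n).
Proof.
case: n => [_|n]; last exact.
by move=> A B f g _; exists \0 => x; rewrite /= [RHS]thinmx0.
Qed.

Section Fiber.
Variables (C : cochain_complex R) (x : R).

(** The homotopy fibre of multiplication by x on C. *)
Definition fiber_diff n (u : (C n * cprev C n)%type) :
    (C n.+1 * cprev C n.+1)%type :=
  (diff C n u.1, x *: u.1 - dprev C n u.2).

Lemma fiber_diff_linear n : linear (@fiber_diff n).
Proof.
move=> c u v; congr (_, _) => /=; first exact: linearP.
rewrite linearP scalerDr [c *: (_ - _)]scalerBr opprD addrACA.
by rewrite !scalerA mulrC.
Qed.

Lemma fiber_diffK n u :
  mklinear (@fiber_diff_linear n.+1) (mklinear (@fiber_diff_linear n) u) = 0.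
Proof.
congr (_, _); first exact: diffK.
by rewrite /= linearB linearZ diff_dprev subr0 subrr.
Qed.

Definition fiber : cochain_complex R := CochainComplex fiber_diffK.

End Fiber.

End Complexes.

(** * Torsion cohomology of torsion resolutions *)

Section Resolutions.
Local Open Scope ring_scope.
Variables (R : comPzRingType) (a : ideal R) (M : lmodType R).
Implicit Types C : cochain_complex R.

Definition torsion_cocycle C n (u : C n) := diff C n u = 0 /\ tors a u.

Definition torsion_boundary C n (u : C n) :=
  exists2 v, tors a v & dprev C n v = u.

(** Up to a-torsion, C is a resolution of a quotient of M placed in degree k:
    sigma identifies a quotient of M with H^k(C), and the cohomology in lower
    degrees is torsion. Injective resolutions of M are of this form with k = 0,
    and a homotopy fibre raises k by one. *)
Definition torsion_resolution C k (sigma : {linear M -> C k}) :=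
  [/\ forall n, injective_module (C n),
      forall n (u : C n), (n < k)%N -> diff C n u = 0 ->
        tors_mod a (@boundary R C n) u,
      forall n (u : C n), (k < n)%N -> diff C n u = 0 -> boundary u,
      forall m, diff C k (sigma m) = 0 &
      forall u : C k, diff C k u = 0 -> exists m, boundary (u - sigma m)].

(** M / kernel_mod sigma is the quotient of H^k(C) by its a-torsion. *)
Definition kernel_mod C k (sigma : {linear M -> C k}) (m : M) :=
  tors_mod a (@boundary R C k) (sigma m).

Lemma torsion_cocycle_submodule C n : submodule (@torsion_cocycle C n).
Proof.
split=> [|c u v [du tu] [dv tv]].
  by split; [exact: linear0|exact: submodule0 (tors_submodule _ _)].
split; first by rewrite linearP du dv scaler0 addr0.
by case: (tors_submodule a (C n)) => _; apply.
Qed.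

Lemma torsion_boundary_submodule C n : submodule (@torsion_boundary C n).
Proof.
split=> [|c _ _ [u tu <-] [v tv <-]].
  by exists 0; [exact: submodule0 (tors_submodule _ _)|exact: linear0].
exists (c *: u + v); last by rewrite linearP.
by case: (tors_submodule a (cprev C n)) => _; apply.
Qed.

Lemma torsion_boundary_cocycle C n (u : C n) :
  torsion_boundary u -> torsion_cocycle u.
Proof.
by move=> [v tv <-]; split; [exact: diff_dprev|exact: tors_linear].
Qed.

Lemma kernel_mod_submodule C k (sigma : {linear M -> C k}) :
  submodule (kernel_mod sigma).
Proof.
have Bs := tors_mod_submodule a (@boundary_submodule R C k).
split=> [|c x y Lx Ly]; rewrite /kernel_mod ?linear0 ?linearP.
  exact: submodule0 Bs.
by case: Bs => _; apply.
Qed.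

Lemma kernel_mod_torsion_free C k (sigma : {linear M -> C k}) m :
  tors_mod a (kernel_mod sigma) m -> kernel_mod sigma m.
Proof.
move=> Lm; apply: tors_mod_closed => r /Lm[n Ln].
by exists n; rewrite -linearZ.
Qed.

Hypothesis noethR : noetherian_ring R.

(** Modulo its torsion, C is exact below degree k and still consists of
    injective modules, so it has a contracting homotopy h there, built degree
    by degree: h d must agree modulo torsion with u |-> u - d (h u), which
    vanishes modulo torsion on the u with d u torsion. Only the consequence
    d h d = d modulo torsion is recorded. *)
Lemma torsion_contraction C k (sigma : {linear M -> C k}) n :
  torsion_resolution sigma -> (n <= k)%N ->
  exists h : {linear C n -> cprev C n},
    forall v, tors a (dprev C n v - dprev C n (h (dprev C n v))).
Proof.
move=> [injC low _ _ _]; elim: n => [_|n IHn ltnk].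
  exists \0 => v; rewrite /= subrr.
  exact: submodule0 (tors_submodule _ _).
have [h hP] := IHn (ltnW ltnk).
have [t [tt tP]] := torsion_summand a noethR (injC n).
have [t' [t't t'P]] := torsion_summand a noethR (injC n.+1).
have kert (y : C n) : tors a y -> y - t y = 0 by move=> /tt ->; rewrite subrr.
have lw : linear (fun u => u - dprev C n (h u)).
  by move=> c u v; rewrite (linearP h) (linearP (dprev C n)) opprD addrACA scalerBr.
have lg : linear (fun u => mklinear lw u - t (mklinear lw u)).
  move=> c u v; rewrite (linearP (mklinear lw)) (linearP t).
  by rewrite opprD addrACA -scalerBr.
have lr : linear (fun u => diff C n u - t' (diff C n u)).
  move=> c u v; rewrite (linearP (diff C n)) (linearP t').
  by rewrite opprD addrACA -scalerBr.
have [u du0|h' h'P] :=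
    injective_factor (f := mklinear lr) (g := mklinear lg) (injC n).
  apply: kert; apply: tors_mod_closed => r ra.
  have [s rs0] : exists s, r ^+ s *: diff C n u = 0.
    have /eqP : diff C n u - t' (diff C n u) = 0 by [].
    by rewrite subr_eq0 => /eqP ->; exact: t'P.
  have dru0 : diff C n (r ^+ s *: u) = 0 by rewrite linearZ.
  have [l [v vE]] := low _ _ ltnk dru0 r ra.
  exists (l + s)%N; rewrite -linearZ exprD -scalerA -vE; exact: hP.
have lh : linear (fun u => h' (u - t' u)).
  by move=> c u v; rewrite (linearP t') opprD addrACA -scalerBr linearP.
exists (mklinear lh) => u.
have hE : mklinear lh (diff C n u) = mklinear lw u - t (mklinear lw u).
  exact: h'P.
rewrite [dprev C n.+1]/= hE -linearB /mklinear /linear_of /= opprB opprB.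
rewrite addrCA [u + _]addrC subrK linearD diff_dprev addr0.
exact/tors_linear/tP.
Qed.

(** Modulo torsion, the quotient of C^k by the boundaries is torsion-free,
    because the boundaries are a direct summand of C^k. *)
Lemma torsion_lift C k (sigma : {linear M -> C k}) (u : C k) :
  torsion_resolution sigma -> tors_mod a (@boundary R C k) u ->
  exists2 g, tors a g & boundary (u - g).
Proof.
move=> res ut; have [h hP] := torsion_contraction res (leqnn k).
exists (u - dprev C k (h u)); last by exists (h u); rewrite opprB addrC subrK.
apply: tors_mod_closed => r /ut[n [v vE]]; exists n.
by rewrite scalerBr -!linearZ -vE; exact: hP.
Qed.

Section FiberStep.
Variables (C : cochain_complex R) (k : nat) (sigma : {linear M -> C k}).
Variable x : R.
Hypothesis res : torsion_resolution sigma.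
Hypothesis xreg : forall m, kernel_mod sigma (x *: m) -> kernel_mod sigma m.

Lemma fiber_map_linear :
  linear (fun m => (0, sigma m) : (C k.+1 * cprev C k.+1)%type).
Proof.
by move=> c m m'; congr (_, _) => /=; rewrite ?scaler0 ?addr0 ?linearP.
Qed.

Definition fiber_map : {linear M -> fiber C x k.+1} := mklinear fiber_map_linear.

(** By the long exact sequence of the fibre, H^k(fiber) is built from
    H^(k-1)(C) and the kernel of x on H^k(C), both torsion as x is regular on
    H^k(C) modulo torsion, while H^(k+1)(fiber) = H^k(C) / x. *)
Lemma fiber_resolution : torsion_resolution fiber_map.
Proof.
have [injC low high scoc sonto] := res.
have Bs n := @boundary_submodule R C n.
split.
- by move=> n; apply: injective_prod; [|exact: injective_cprev].
- move=> n [u w]; rewrite ltnS => lenk [du0 /eqP]; rewrite subr_eq0 => /eqP xu.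
  have ut : tors_mod a (@boundary R C n) u.
    move: lenk; rewrite leq_eqVlt => /orP[/eqP nk|/low]; last exact.
    subst n; have [m [v vE]] := sonto u du0.
    have uE : u = sigma m + dprev C k v by rewrite vE addrC subrK.
    have mt : kernel_mod sigma m.
      apply: xreg; apply: sub_tors_mod; exists (w - x *: v).
      by rewrite linearB linearZ /= -xu uE scalerDr addrK linearZ.
    rewrite uE; apply: (submoduleD (tors_mod_submodule a (Bs _)) mt).
    by apply: sub_tors_mod; exists v.
  move=> r ra; have [s [v vE]] := ut r ra.
  case: n => [|n] in u w lenk du0 xu ut v vE *.
    exists s, 0; congr (_, _); last by rewrite [LHS]thinmx0 [RHS]thinmx0.
    exact: vE.
  have [|t [y yE]] := low _ (r ^+ s *: w - x *: v) lenk _ r ra.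
    rewrite /= in xu vE; rewrite linearB !linearZ /= -xu vE.
    by rewrite scalerN !scalerA mulrC subrr.
  exists (t + s)%N, (r ^+ t *: v, - y); rewrite /= in xu vE yE *.
  congr (_, _) => /=; first by rewrite linearZ /= vE exprD -scalerA.
  by rewrite linearN opprK yE scalerBr addrC !scalerA exprD [x * _]mulrC subrK.
- move=> [//|n] [u w]; rewrite ltnS => ltkn [du0 /eqP]; rewrite subr_eq0 => /eqP xu.
  have [v /= vE] := high _ u (ltnW ltkn) du0.
  have [|y yE] := high _ (x *: v - w) ltkn.
    by rewrite linearB linearZ /= vE xu subrr.
  exists (v, y); congr (_, _) => //=.
  by rewrite yE opprB addrC subrK.
- move=> m; congr (_, _) => /=; first exact: linear0.
  by rewrite scaler0 sub0r scoc oppr0.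
- move=> [u w] [du0 /eqP]; rewrite subr_eq0 => /eqP xu.
  have [v /= vE] := high _ u (ltnSn k) du0.
  have [|m [y yE]] := sonto (x *: v - w).
    by rewrite linearB linearZ /= vE xu subrr.
  exists (- m), (v, y); rewrite linearN opprK.
  congr (_, _) => /=; first by rewrite vE addr0.
  by rewrite yE !opprB addrCA [x *: v + _]addrC subrK addrC.
Qed.

Lemma kernel_mod_fiber m : kernel_mod sigma m -> kernel_mod fiber_map m.
Proof.
move=> mt r /mt[n [v vE]]; exists n, (0, - v).
congr (_, _) => /=; first by rewrite linear0 scaler0.
by rewrite scaler0 sub0r linearN opprK vE.
Qed.

Lemma kernel_mod_fiber_scale m : kernel_mod fiber_map (x *: m).
Proof.
have [_ _ _ scoc _] := res.
apply: sub_tors_mod; exists (sigma m, 0); congr (_, _) => /=.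
  exact: scoc.
by rewrite linear0 subr0 linearZ.
Qed.

(** Since a torsion cocycle z with x z = d w, w torsion, lifts to the torsion
    cocycle (z, w) of the fibre, the kernel of x on the torsion cohomology of C
    is a quotient of the torsion cohomology of the fibre in the same degree. *)
Lemma dcc_fiber n : x \in a ->
  dcc_between (@torsion_boundary (fiber C x) n.+1)
    (@torsion_cocycle (fiber C x) n.+1) ->
  dcc_between (@torsion_boundary C n.+1) (@torsion_cocycle C n.+1).
Proof.
move=> xa dccF; apply: (@dcc_locally_nilpotent _ _ _ _ x).
- exact: torsion_boundary_submodule.
- exact: torsion_cocycle_submodule.
- exact: torsion_boundary_cocycle.
- move=> z [_ /(_ x xa)[s xs]]; exists s; rewrite xs.
  exact: submodule0 (torsion_boundary_submodule _ _).
apply: (@dcc_transfer _ _ _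
  (fun z (u : fiber C x n.+1) => z = (u : (C n.+1 * cprev C n.+1)%type).1))
  dccF => //.
- by move=> c z u z' u' -> ->.
- exact: torsion_boundary_submodule.
- exact: torsion_cocycle_submodule.
- exact: torsion_boundary_cocycle.
- move=> z [[dz tz] [w tw wE]]; exists (z, w) => //; split.
    congr (_, _) => //=; rewrite /= in wE; by rewrite wE subrr.
  move=> r ra; have [[s rs] [t rt]] := (tz r ra, tw r ra).
  exists (maxn s t); congr (_, _) => /=.
    exact: submodule_pow_le (submodule_eq0 _) (leq_maxl s t) rs.
  exact: submodule_pow_le (submodule_eq0 _) (leq_maxr s t) rt.
- move=> z [u w] _ /= -> [[v y] vt [vE _]]; exists v => // r /vt[s vs].
  by exists s; case: vs.
Qed.

(** The kernel of x on the torsion cohomology in degree k + 1 embeds into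
    Gamma_a(M / N) for N = L + x M, L = kernel_mod sigma: if x z = d w with w
    torsion and z = d u, then x u - w is a cocycle of degree k, the class of
    sigma m for some m. This m is unique modulo N, for u may be changed by
    cocycles and w by torsion cocycles. Going through the fibre would only give
    Gamma_a of a quotient of M by a submodule that may be smaller than N, whose
    support is then too large. *)
Lemma dcc_first (N : submodClosed M) : x \in a ->
  (forall m, m \in N <-> exists l m', kernel_mod sigma l /\ m = l + x *: m') ->
  dcc_between (fun m => m \in N) (tors_mod a (fun m => m \in N)) ->
  dcc_between (@torsion_boundary C k.+1) (@torsion_cocycle C k.+1).
Proof.
move=> xa NP dccN; have [injC low high scoc sonto] := res.
have Bs := @boundary_submodule R C k; have Bts := tors_mod_submodule a Bs.
have Ls := kernel_mod_submodule sigma.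
have xcomm r (u : C k) : x *: (r *: u) = r *: (x *: u).
  by rewrite !scalerA mulrC.
apply: (@dcc_locally_nilpotent _ _ _ _ x).
- exact: torsion_boundary_submodule.
- exact: torsion_cocycle_submodule.
- exact: torsion_boundary_cocycle.
- move=> z [_ /(_ x xa)[s xs]]; exists s; rewrite xs.
  exact: submodule0 (torsion_boundary_submodule _ _).
apply: (@dcc_transfer _ _ _ (fun z m => exists u w,
  [/\ z = diff C k u, tors a w & boundary (x *: u - w - sigma m)])) dccN.
- exists 0, 0; split; first by rewrite linear0.
    exact: submodule0 (tors_submodule _ _).
  by rewrite scaler0 (linear0 sigma) !subr0; exact: submodule0 Bs.
- move=> c z m z' m' [u [w [-> tw Bu]]] [u' [w' [-> tw' Bu']]].
  exists (c *: u + u'), (c *: w + w'); split; first by rewrite linearP.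
    by case: (tors_submodule a (C k)) => _; apply.
  have -> : x *: (c *: u + u') - (c *: w + w') - sigma (c *: m + m') =
      c *: (x *: u - w - sigma m) + (x *: u' - w' - sigma m').
    rewrite (linearP sigma) scalerDr !opprD [X in X + _ = _]addrACA [LHS]addrACA.
    by rewrite !scalerBr !scalerA mulrC.
  by case: Bs => _; apply.
- exact: submodule_mem.
- exact/tors_mod_submodule/submodule_mem.
- by move=> m; exact: sub_tors_mod.
- move=> z [[dz tz] [w tw wE]]; have [u uE] := high _ z (ltnSn k) dz.
  have [|m mB] := sonto (x *: u - w).
    by rewrite linearB linearZ /= [diff _ _ u]uE [diff _ _ w]wE subrr.
  exists m; last by exists u, w.
  move=> r ra; have [[s zs] [t wt]] := (tz r ra, tw r ra).
  pose e := maxn s t; exists e.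
  have {}zs : r ^+ e *: z = 0.
    exact: submodule_pow_le (submodule_eq0 _) (leq_maxl s t) zs.
  have {}wt : r ^+ e *: w = 0.
    exact: submodule_pow_le (submodule_eq0 _) (leq_maxr s t) wt.
  have [|m1 m1B] := sonto (r ^+ e *: u).
    by rewrite linearZ /= [diff _ _ u]uE.
  apply/NP; exists (r ^+ e *: m - x *: m1), m1; split; last by rewrite subrK.
  apply: sub_tors_mod.
  have -> : sigma (r ^+ e *: m - x *: m1) =
      x *: (r ^+ e *: u - sigma m1) - r ^+ e *: (x *: u - w - sigma m).
    rewrite (linearB sigma) !(linearZ_LR sigma) !scalerBr wt subr0 opprB.
    by rewrite xcomm [RHS]addrC addrA subrK.
  by apply: submoduleB => //; exact: submoduleZ.
move=> z m [[dz tz] _] [u [w [zE tw Bu]]] /NP[l [m1 [Ll mE]]].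
have [u1 u1E] : exists u1, u1 = u - sigma m1 by exists (u - sigma m1).
have zE1 : z = diff C k u1 by rewrite u1E linearB scoc subr0.
have Bu1 : boundary (x *: u1 - w - sigma l).
  suff -> : x *: u1 - w - sigma l = x *: u - w - sigma m by [].
  rewrite mE (linearD sigma) (linearZ_LR sigma) u1E scalerBr opprD addrA.
  by rewrite [X in X - sigma l = _]addrAC [LHS]addrAC.
(* If m is in N, then u can be chosen with x u torsion modulo boundaries; as x
   is regular on M / L, u itself is then torsion modulo boundaries. *)
have [g tg [v vE]] : exists2 g, tors a g & boundary (u1 - g).
  apply: torsion_lift => //; apply: tors_mod_closed => r ra.
  have [s zs] := tz r ra; exists s.
  have [|m2 m2B] := sonto (r ^+ s *: u1).
    by rewrite linearZ /= -zE1.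
  have Lm2 : kernel_mod sigma m2.
    apply: xreg; rewrite -[x *: m2](subrK (r ^+ s *: l)).
    apply: (submoduleD Ls); last exact: (submoduleZ _ Ls).
    rewrite /kernel_mod.
    have -> : sigma (x *: m2 - r ^+ s *: l) =
        r ^+ s *: (x *: u1 - w - sigma l) + r ^+ s *: w -
        x *: (r ^+ s *: u1 - sigma m2).
      rewrite (linearB sigma) !(linearZ_LR sigma) !scalerBr opprB.
      rewrite [X in _ = X + _]addrAC (subrK (r ^+ s *: w)).
      by rewrite xcomm [RHS]addrC addrA subrK.
    apply: (submoduleB Bts); last by apply: sub_tors_mod; exact: (submoduleZ _ Bs).
    apply: (submoduleD Bts); first by apply: sub_tors_mod; exact: (submoduleZ _ Bs).
    apply: (submoduleZ _ Bts) => r' /tw[t wt]; exists t; rewrite wt.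
    exact: submodule0 Bs.
  rewrite -[_ *: u1](subrK (sigma m2)); apply: (submoduleD Bts) => //.
  exact: sub_tors_mod.
exists g => //; rewrite zE1 /= -(subrK g u1) -vE linearD.
by rewrite diff_dprev add0r.
Qed.

End FiberStep.

End Resolutions.

(** * Artinianness of local cohomology *)

Section Artinianness.
Local Open Scope ring_scope.
Variables (R : comPzRingType) (a : ideal R) (M : lmodType R).
Hypothesis noethR : noetherian_ring R.
Hypothesis zdM : ZD_module M.
Hypothesis finM : forall N : submodClosed M, finite_Gdim a (quotmod N).

(** Induction on the distance i + 1 of the degree from k: passing to the fibre
    of a regular element decreases both this distance and the dimension. *)
Lemma dcc_torsion_resolution i (C : cochain_complex R) k
    (sigma : {linear M -> C k}) :
  torsion_resolution a sigma -> small_dim a (kernel_mod a sigma) i.+1 ->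
  dcc_between (@torsion_boundary R a C (k + i).+1)
    (@torsion_cocycle R a C (k + i).+1).
Proof.
elim: i C k sigma => [|i IHi] C k sigma res smalld;
  have Ls := kernel_mod_submodule a sigma;
  have [x xa xreg] := ZD_regular_element zdM Ls
    (@kernel_mod_torsion_free _ _ _ _ _ sigma).
  have Ns : submodule (fun m => exists l m', kernel_mod a sigma l /\ m = l + x *: m').
    split=> [|c _ _ [l [m [Ll ->]]] [l' [m' [Ll' ->]]]].
      by exists 0, 0; rewrite scaler0 addr0; split=> //; exact: (submodule0 Ls).
    exists (c *: l + l'), (c *: m + m'); split; first by case: Ls => _; apply.
    by rewrite !scalerDr !scalerA [x * c]mulrC addrACA.
  rewrite addn0; apply: (dcc_first noethR res xreg (N := mksubmod Ns)) => //.
    by move=> m; exact: mksubmodP.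
  apply: dcc_tors_mod => //; case: smalld => [|dimd]; first by left.
  right; apply: (dim_mod_regular (x := x)) dimd => // [m Lm|m].
    apply/mksubmodP; exists m, 0; by rewrite scaler0 addr0.
  apply/mksubmodP; exists 0, m; rewrite add0r; split=> //.
  exact: (submodule0 Ls).
rewrite -addSnnS; apply: (dcc_fiber (x := x)) => //.
apply: (IHi _ _ (fiber_map sigma x)); first exact: fiber_resolution.
case: smalld => [|dimd]; [by left|right].
apply: (dim_mod_regular (x := x)) dimd => // m.
  exact: kernel_mod_fiber.
exact: kernel_mod_fiber_scale.
Qed.

Lemma artinian_local_cohomology (I : injective_resolution M) n :
  dcc_between (@torsion_boundary R a I n) (@torsion_cocycle R a I n) ->
  artinian_module (local_cohomology a I n).
Proof.
move=> dccI; apply: dcc_artinian.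
apply: (@dcc_transfer R (local_cohomology a I n) (I n) (fun h u =>
    exists z : submod_of (@cocycle R (torsion_complex a I) n),
      h = quotmod_proj (@coboundary R (torsion_complex a I) n) z /\
      u = val (val z))) dccI.
- by exists 0; rewrite linear0.
- move=> c h u h' u' [z [-> ->]] [z' [-> ->]]; exists (c *: z + z').
  by split; [exact/esym/linearP|].
- exact: torsion_boundary_submodule.
- exact: torsion_cocycle_submodule.
- exact: torsion_boundary_cocycle.
- move=> h _; have [z <-] := quotmod_proj_surj h.
  exists (val (val z)); last by exists z.
  split; last by apply/(torsion_predP _ noethR); exact: valP.
  by have /eqP/(congr1 val) := valP z.
- move=> h u _ [z [-> zE]] [v vt vE]; apply/quotmod_proj_eq0/asboolP.
  case: n => [|n] in z h u v vt vE zE *.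
    by apply: val_inj; rewrite /= -zE -vE.
  have vT : v \in torsion_pred a (I n) by apply/(torsion_predP _ noethR).
  by exists (SubmodOf vT); apply: val_inj; rewrite /= -zE -vE.
Qed.

Lemma local_cohomology_artinian (I : injective_resolution M) n :
  small_dim a (fun m : M => m = 0) n -> artinian_module (local_cohomology a I n).
Proof.
move=> smalld; apply: artinian_local_cohomology.
case: n => [|n] in smalld *.
  have dcc0 := dcc_tors_mod noethR (finM (mksubmod (submodule_eq0 M))).
  have {dcc0} : dcc_between (fun m : M => m = 0) (tors a (X := M)).
    apply: dcc_mono (dcc0 _) => [m /mksubmodP //|m mt r /mt[s rs]|].
      by exists s; apply/mksubmodP.
    case: smalld => [|dimd]; [by left|right].
    by apply: dim_mod_sub dimd => m ->; apply/mksubmodP.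
  apply: (@dcc_transfer _ _ _ (fun u m => res_aug I m = u)).
  - exact: linear0.
  - by move=> c _ m _ m' <- <-; rewrite linearP.
  - exact: submodule_eq0.
  - exact: tors_submodule.
  - by move=> _ ->; exact: submodule0 (tors_submodule _ _).
  - move=> u [/res_exact0[m mE] tu]; exists m => // r /tu[s rs]; exists s.
    by apply: (@res_aug_inj _ _ I); rewrite linearZ /= mE rs linear0.
  - move=> _ _ _ <- ->; rewrite linear0.
    exact: submodule0 (torsion_boundary_submodule _ _ _).
have res : torsion_resolution a (res_aug I : {linear M -> (I : cochain_complex R) 0}).
  split=> [||[//|l] u _ /res_exactS[v vE]|m|u /res_exact0[m <-]] //.
  - exact: res_injective.
  - by exists v.
  - by apply/res_exact0; exists m.
  - by exists m, 0; rewrite subrr.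
apply: (dcc_torsion_resolution (i := n) res).
case: smalld => [|dimd]; [by left|right].
apply: dim_mod_sub dimd => m ->.
exact: submodule0 (kernel_mod_submodule _ _).
Qed.

End Artinianness.

Theorem corollary3p3 (R : comPzRingType) (a : ideal R)
    (M : lmodType R) :
  noetherian_ring R ->
  ZD_module M ->
  (forall N : submodClosed M, finite_Gdim a (quotmod N)) ->
  (krull_dim_is (quotmod a) 0 ->
     forall (I : injective_resolution M) (i : nat),
       artinian_module (local_cohomology a I i)) /\
  (forall d : nat, krull_dim_is M d ->
     forall I : injective_resolution M,
       artinian_module (local_cohomology a I d)).
Proof.
move=> noethR zdM finM; split=> [[_ dimRa] I i|d [_ dimM] I].
  apply: local_cohomology_artinian => //; left=> p q pp qp ap pq.
  have supp (p' : ideal R) : prime_ideal p' -> {subset a <= p'} ->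
      Supp (quotmod a) p'.
    move=> pp' ap'; split=> //; exists (quotmod_proj a 1%R), 1%R.
    split=> [|[u up]]; first by case: pp'.
    rewrite scaler0 subr0 scale1r -linearZ => /quotmod_proj_eq0 /ap'.
    by rewrite /GRing.scale /= mulr1 (negbTE up).
  apply: contrapT => nqp; suff : (1 <= 0)%N by [].
  apply: (dimRa _ (fun i => if i is 0 then p else q)); split=> [[|j] _|[|j] //].
  - exact: supp.
  - by apply: supp => // r /ap/pq.
apply: local_cohomology_artinian => //; right=> n c cS cC.
apply: (dimM n c); split=> // j /cS[cp [m mP]]; split=> //.
exists m, 1%R; split=> [|[u /mP + um]]; first by case: cp.
by apply; move: um; rewrite scaler0 subr0 scale1r.
Qed.
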